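(* There exist universal constants $C,C_1,C_2,\gamma>0$ such that the following holds. Let $0<q<1$, let $\Theta$ be a positive integer, let $I=[a,b]$, and let $\nu$ be a probability measure on $I$ with density $\nu(x)$. Let $N,m,s$ be positive integers and $K\ge 1$ with $$m\ge C K^2 s\log^3(s)\log(N+1).$$ Let $\{\psi_0,\psi_1,\dots,\psi_N\}$ be polynomials on $I$ that are orthonormal with respect to $\nu$, whose degrees are strictly increasing and do not exceed $N$, and that are uniformly bounded: $\|\psi_k\|_\infty\le K$ for $k=0,\dots,N$. Let $x_1,\dots,x_m$ be drawn independently from $I$, each with probability density $\nu(x)$, and let $A\in\mathbb{R}^{m\times(N+1)}$ have entries $A_{j,k}=\psi_k(x_j)$, $j=1,\dots,m$, $k=0,\dots,N$. Let $f\in C[a,b]$ be arbitrary, put $\mathbf{y}=(f(x_1),\dots,f(x_m))^T$, let $p_{opt}$ be the best square approximation polynomial of $f$ in $\Pi_N(I)=\mathrm{span}\{\psi_0,\dots,\psi_N\}$, let $\mathbf{c_{opt}}$ be the coefficient vector of $p_{opt}$ in the basis $\{\psi_k\}_{k=0}^N$, and let $T_N=f-p_{opt}$. Then, with probability at least $1-(N+1)^{-\gamma\log^3(s)}$, the following holds: if $\mathbf{c}^\#=(c_0^\#,\dots,c_N^\#)^T$ is a solution of $$\min_{\mathbf{z}\in\mathbb{R}^{N+1}}\|\mathbf{z}\|_1\quad\text{subject to}\quad \|A\mathbf{z}-\mathbf{y}\|_2\le\Theta\sqrt{m}\,\|T_N\|_\infty,$$ and $p^\#=\sum_{k=0}^N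 c_k^\#\psi_k$, then $$\|f-p^\#\|_2\le\|T_N\|_2+C_1\frac{\sigma_s(\mathbf{c_{opt}})_1}{\sqrt{s}}+C_2\Theta\|T_N\|_\infty$$ and $$\|f-p^\#\|_2\le\|T_N\|_2+C_1\|f\|_{A_q}s^{\frac12-\frac1q}+C_2\Theta\|T_N\|_\infty.$$
   Context: $\|g\|_\infty=\max_{x\in[a,b]}|g(x)|$ and, for functions, $\|g\|_2=\left(\int_a^b g(x)^2\nu(x)\,dx\right)^{1/2}$. $\Pi_N(I)$ is the space of polynomials on $I$ of degree at most $N$. The best square approximation polynomial $p_{opt}\in\Pi_N(I)$ satisfies $\|f-p_{opt}\|_2=\inf_{p\in\Pi_N(I)}\|f-p\|_2$. Orthonormal with respect to $\nu$ means $\int_I\psi_j(x)\psi_k(x)\nu(x)\,dx=\delta_{jk}$. For a vector (or sequence) $\mathbf{z}$: $\|\mathbf{z}\|_p=(\sum_j|z_j|^p)^{1/p}$ for $0<p<\infty$ (a quasi-norm for $p<1$), $\|\mathbf{z}\|_0$ is the number of nonzero entries, and the best $s$-term approximation error is $\sigma_s(\mathbf{z})_p=\inf\{\|\mathbf{z}-\mathbf{x}\|_p:\|\mathbf{x}\|_0\le s\}$. For $g=\sum_k c_k\psi_k$, $\|g\|_{A_q}:=\|\mathbf{c}\|_q$, $q>0$. For the continuous function $f$, $\|f\|_{A_q}$ is the $\ell_q$ quasi-norm (possibly $+\infty$) of the sequence of generalized Fourier coefficients $c_k=\int_I f(x)\psi_k(x)\nu(x)\,dx$, $k=0,1,2,\dots$,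 where $\{\psi_k\}_{k\ge0}$ is the orthonormal polynomial system with respect to $\nu$ (with $\psi_k$ of degree $k$) extending $\psi_0,\dots,\psi_N$. ''Universal constants'' means independent of all the other data. *)

(* Defs.v *)
(* Stated with MathComp and MathComp-Analysis, over an arbitrary realType. *)
From HB Require Import structures.
From mathcomp Require Export all_boot all_order all_algebra.
From mathcomp Require Export all_classical all_reals all_analysis.
Export Order.TTheory GRing.Theory Num.Theory.
Export numFieldNormedType.Exports.

Set Implicit Arguments.
Unset Strict Implicit.
Unset Printing Implicit Defensive.

Local Open Scope classical_set_scope.
Local Open Scope ring_scope.

Section Vectors.
Context {R : realType}.

Definition lpnorm n (p : R) (z : 'cV[R]_n) : R :=
  (\sum_i `|z i 0| `^ p) `^ p^-1.

Definition l0norm n (z : 'cV[R]_n) : nat := #|[set i | z i 0 != 0]%SET|.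

Definition best_sterm_error n (s : nat) (p : R) (z : 'cV[R]_n) : R :=
  inf [set lpnorm p (z - x) | x in [set x | (l0norm x <= s)%N]].

(* Extended-real valued: the value is +oo when the series diverges. *)
Definition lqnorm_seq (q : R) (c : nat -> R) : \bar R :=
  (poweR (\sum_(0 <= k <oo) (`|c k| `^ q)%:E) q^-1)%E.

(* [c] solves: minimize ||z||_1 subject to ||A z - y||_2 <= eta. *)
Definition l1_minimizer m n (A : 'M[R]_(m, n)) (y : 'cV[R]_m) (eta : R)
    (c : 'cV[R]_n) : Prop :=
  lpnorm 2 (A *m c - y) <= eta /\
  forall z : 'cV[R]_n, lpnorm 2 (A *m z - y) <= eta -> lpnorm 1 c <= lpnorm 1 z.

End Vectors.

Section Functions.
Context {R : realType}.
Variables (a b : R) (nu : R -> R).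

Definition probability_density : Prop :=
  [/\ measurable_fun `[a, b] nu,
      forall x, x \in `[a, b] -> 0 <= nu x
    & (\int[lebesgue_measure]_(x in `[a, b]) (nu x)%:E = 1)%E].

(* For g continuous on [a, b], with a <= b, this supremum is the maximum. *)
Definition supnorm (g : R -> R) : R := sup [set `|g x| | x in `[a, b]].

Definition dot (g h : R -> R) : R :=
  \int[lebesgue_measure]_(x in `[a, b]) (g x * h x * nu x).

Definition L2norm (g : R -> R) : R :=
  Num.sqrt (\int[lebesgue_measure]_(x in `[a, b]) (g x ^+ 2 * nu x)).

Definition orthonormal (I : eqType) (psi : I -> {poly R}) : Prop :=
  forall j k, dot (horner (psi j)) (horner (psi k)) = (j == k)%:R.

(* [p] is the best approximation of [f] by polynomials of degree at most [N];
   degrees are size - 1. *)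
Definition best_square_approx (f : R -> R) (N : nat) (p : {poly R}) : Prop :=
  (size p <= N.+1)%N /\
  L2norm (fun x => f x - p.[x]) =
    inf [set L2norm (fun x => f x - r.[x]) | r in
          [set r : {poly R} | (size r <= N.+1)%N]].

(* [Psi] is the full orthonormal polynomial system, with [Psi k] of degree [k],
   extending the finite family [psi]. *)
Definition orthonormal_extension N (psi : 'I_N.+1 -> {poly R})
    (Psi : nat -> {poly R}) : Prop :=
  [/\ orthonormal Psi,
      forall k, size (Psi k) = k.+1
    & forall k : 'I_N.+1, Psi k = psi k].

Definition Aq_norm (q : R) (Psi : nat -> {poly R}) (f : R -> R) : \bar R :=
  lqnorm_seq q (fun k => dot f (horner (Psi k))).

Definition expansion n (psi : 'I_n -> {poly R}) (c : 'cV[R]_n) : {poly R} :=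
  \sum_k c k 0 *: psi k.

Definition sampling_matrix m n (psi : 'I_n -> {poly R}) (x : 'I_m -> R) :
    'M[R]_(m, n) :=
  \matrix_(j, k) (psi k).[x j].

End Functions.

Section Probability.
Context {R : realType} {d : measure_display} {T : measurableType d}.
Variable P : probability T R.

Definition has_density (a b : R) (nu : R -> R) (X : {RV P >-> R}) : Prop :=
  forall B : set R, measurable B ->
    distribution P X B =
      (\int[lebesgue_measure]_(x in B `&` `[a, b]) (nu x)%:E)%E.

Definition mutually_independent m (X : 'I_m -> {RV P >-> R}) : Prop :=
  forall (J : {set 'I_m}) (B : 'I_m -> set R),
    (forall j, measurable (B j)) ->
    P (\bigcap_(j in [set` J]) X j @^-1` B j) =
      (\prod_(j in J) P (X j @^-1` B j))%E.

(* The set [S] of good outcomes need not be measurable itself, so it is only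
   required to contain a measurable event of probability at least [r]. *)
Definition with_probability_at_least (r : R) (S : set T) : Prop :=
  exists E : set T, [/\ measurable E, E `<=` S & (r%:E <= P E)%E].

End Probability.

(* Main.v *)
Require Import Defs.
From mathcomp Require Import ring lra zify measurable_realfun.

(* It suffices to show, with high probability, that every coefficient vector z with
   ||z||_1 <= 2^L (where 16 s <= 4^L <= 64 s) and F = sum_i z_i psi_i satisfies
   ||z||_2^2 <= 51 (1/m) sum_j F(x_j)^2 + 1/2. Indeed the l1-minimality of c# puts
   h = c# - c_opt in the cone where ||h||_1 is at most 2 sqrt(s) ||h||_2 plus twice the
   best s-term error, so either ||h||_2 is bounded by that error over sqrt(s), or the
   inequality applies to h / ||h||_2 and bounds ||h||_2 by the residual.

   The inequality is one-sided and is proved level by level, following Haviv and Regev.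
   Split F^2 into min(F^2, K^2) and the dyadic levels |F| > K 2^l, l < L; there are only
   O(log s) of them since |F| <= K 2^L. On each level F is replaced by an average G of k
   elements of the dictionary {+- 2^L psi_i}, with k = O(4^L) for the truncated part and
   k = O(L 4^(L-l)) for level l. Maurey's random choice makes F - G small simultaneously
   under nu and on the sample; a tail bound proportional to the variance, and not only to
   its maximum K^2 4^L, avoids a factor log K. The averages G form a finite net, on which
   Chernoff's lower tail and a union bound give the comparison of empirical and true mean. *)

Set Implicit Arguments.
Unset Strict Implicit.
Unset Printing Implicit Defensive.

Local Open Scope classical_set_scope.
Local Open Scope ring_scope.

(** * Integration against independent samples *)

Section WeightedPushforward.
Context {R : realType} {d1 d2 : measure_display}
  {T1 : measurableType d1} {T2 : measurableType d2}.
Variables (mu1 : {measure set T1 -> \bar R}) (mu2 : {measure set T2 -> \bar R}).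
Variables (phi : T1 -> T2) (h : T1 -> R) (c : R).
Hypotheses (mphi : measurable_fun setT phi) (mh : measurable_fun setT h).
Hypotheses (h0 : forall t, 0 <= h t) (c0 : 0 <= c).
Hypothesis hphi : forall B, measurable B ->
  (\int[mu1]_t (h t * \1_B (phi t))%:E = c%:E * mu2 B)%E.

Import HBNNSimple.

Let weighted_nnsfun (g : {nnsfun T2 >-> R}) :
  (\int[mu1]_t (h t * g (phi t))%:E = c%:E * \int[mu2]_y (g y)%:E)%E.
Proof.
transitivity (\int[mu1]_t (\sum_(y \in range g)
   (y * (h t * \1_(g @^-1` [set y]) (phi t)))%:E))%E.
  apply: eq_integral => t _; rewrite fimfunE fsumEFin//; congr EFin.
  by rewrite mulr_fsumr; apply: eq_fsbigr => y _; rewrite mulrCA.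
rewrite ge0_integral_fsum//; last 2 first.
- move=> y; apply/measurable_EFinP; apply: measurable_funM => //.
  apply: measurable_funM => //; apply: measurableT_comp => //.
- move=> y t _; rewrite lee_fin; have [y0|y0] := leP 0 y.
    by rewrite !mulr_ge0.
  rewrite preimage_nnfun0// indicE in_set0 !mulr0 //.
rewrite integralT_nnsfun sintegralE ge0_mule_fsumr; last first.
  by move=> y; exact: nnsfun_mulemu_ge0.
apply: eq_fsbigr => y yg.
under eq_integral do rewrite EFinM.
rewrite ge0_integralZl//.
- by rewrite hphi// muleCA.
- apply/measurable_EFinP.
  by apply: measurable_funM => //; apply: measurableT_comp.
- by move=> t _; rewrite lee_fin mulr_ge0.
- by move: yg; rewrite inE => -[t _ <-]; rewrite lee_fin.
Qed.

(** The identity assumed for indicators extends to simple functions by linearity, then to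
    nonnegative measurable functions by monotone convergence. With [h] the product of the other
    factors it splits off one independent variable; with [h] a density and [phi] the identity it
    computes expectations. *)
Lemma integral_weighted_pushforward (g : T2 -> R) :
  measurable_fun setT g -> (forall y, 0 <= g y) ->
  (\int[mu1]_t (h t * g (phi t))%:E = c%:E * \int[mu2]_y (g y)%:E)%E.
Proof.
move=> mg g0.
have mg' : measurable_fun setT (EFin \o g) by exact/measurable_EFinP.
pose g_ := nnsfun_approx measurableT mg'.
have gcvg y : (g_ n y)%:E @[n --> \oo] --> (g y)%:E.
  by apply: (cvg_nnsfun_approx measurableT mg') => // x _; rewrite lee_fin.
have gnd y : {homo (fun n => g_ n y) : n m / (n <= m)%N >-> n <= m}.
  by move=> m n mn; exact/lefP/nd_nnsfun_approx.
have cvg2 : (\int[mu2]_y (g_ n y)%:E @[n --> \oo] --> \int[mu2]_y (g y)%:E)%E.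
  rewrite (_ : (\int[mu2]_y (g y)%:E =
      \int[mu2]_y (limn (fun n => (g_ n y)%:E)))%E); last first.
    by apply: eq_integral => y _; apply/esym/cvg_lim.
  apply: cvg_monotone_convergence => //.
  - by move=> n; exact/measurable_EFinP.
  - by move=> n y _; rewrite lee_fin.
  - by move=> y _ m n mn; rewrite lee_fin gnd.
have cvg1 : (\int[mu1]_t (h t * g_ n (phi t))%:E @[n --> \oo] -->
             \int[mu1]_t (h t * g (phi t))%:E)%E.
  rewrite (_ : (\int[mu1]_t (h t * g (phi t))%:E =
      \int[mu1]_t (limn (fun n => (h t * g_ n (phi t))%:E)))%E); last first.
    apply: eq_integral => t _; apply/esym/cvg_lim => //.
    under eq_fun do rewrite EFinM.
    rewrite EFinM; exact: cvgeZl.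
  apply: cvg_monotone_convergence => //.
  - move=> n; apply/measurable_EFinP; apply: measurable_funM => //.
    exact: measurableT_comp.
  - by move=> n t _; rewrite lee_fin mulr_ge0.
  - by move=> t _ m n mn; rewrite lee_fin ler_wpM2l// gnd.
have cvg2' : (c%:E * \int[mu2]_y (g_ n y)%:E @[n --> \oo] -->
    c%:E * \int[mu2]_y (g y)%:E)%E by exact: cvgeZl.
rewrite -(cvg_lim _ cvg1)// -(cvg_lim _ cvg2')//.
by apply: congr_lim; apply/funext => n; exact: weighted_nnsfun.
Qed.

End WeightedPushforward.

Section IndependentProduct.
Context {R : realType} {d : measure_display} {T : measurableType d}.
Variables (P : probability T R) (m : nat) (X : 'I_m -> {RV P >-> R}).
Hypothesis indep : mutually_independent X.

(** Induction on the number [n] of leading factors that may be arbitrary, the others being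
    indicators. For [n = 0] the claim is independence itself; each step replaces one indicator by a
    general function. *)
Let integral_prod_mixed (n : nat) (g : 'I_m -> R -> R) (e : 'I_m -> R) :
  (forall j, measurable_fun setT (g j)) -> (forall j x, 0 <= g j x) ->
  (forall j, (\int[P]_w (g j (X j w))%:E = (e j)%:E)%E) ->
  (forall j : 'I_m, (n <= j)%N -> exists2 B, measurable B & g j = \1_B) ->
  (\int[P]_w (\prod_j g j (X j w))%:E = (\prod_j e j)%:E)%E.
Proof.
have PE A : measurable A -> P A = (\int[P]_w (\1_A w)%:E)%E.
  by move=> mA; rewrite integral_indic// setIT.
elim: n g e => [|n IHn] g e mg g0 ge gB.
  have /choice[B HB] : forall j, exists B, measurable B /\ g j = \1_B.
    by move=> j; have [B mB gE] := gB j (leq0n _); exists B.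
  have mXB j : measurable (X j @^-1` B j).
    by have [mB _] := HB j; rewrite -[X in measurable X]setTI; exact: measurable_funP.
  have -> : (\prod_j e j)%:E = (\prod_(j in [set: 'I_m]%SET) P (X j @^-1` B j))%E.
    rewrite (eq_bigr (fun j => (e j)%:E)); last first.
      by move=> j _; rewrite -ge PE//; apply: eq_integral => w _; rewrite (HB j).2.
    by rewrite prodEFin; congr EFin; apply: eq_bigl => j; rewrite inE.
  rewrite -indep; last by move=> j; case: (HB j).
  rewrite PE; last first.
    by apply: fin_bigcap_measurable => // j _; case: (HB j) => mB _; exact: mXB.
  apply: eq_integral => w _; congr EFin.
  rewrite (eq_bigr (fun j => (w \in X j @^-1` B j)%:R)); last first.
    by move=> j _; rewrite (HB j).2 indicE; congr (_%:R); congr nat_of_bool;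
      apply/idP/idP; rewrite !inE.
  rewrite indicE; have [wI|wI] := boolP (w \in _).
    rewrite big1// => j _; rewrite mem_set//.
    by move: wI; rewrite inE => /(_ j); apply => /=; rewrite inE.
  have /existsP[j wj] : [exists j, w \notin X j @^-1` B j].
    apply: contraNT wI => /existsPn wI; rewrite inE => j _.
    by have := wI j; rewrite negbK inE.
  by rewrite (bigD1 j)//= (negbTE wj) mul0r.
have [nm|mn] := ltnP n m; last first.
  by apply: IHn => // j nj; have := leq_trans mn nj; rewrite leqNgt ltn_ord.
pose i := Ordinal nm.
pose c := \prod_(j | j != i) e j.
have e0 j : 0 <= e j.
  by rewrite -lee_fin -ge integral_ge0// => w _; rewrite lee_fin.
transitivity (\int[P]_w (\prod_(j | j != i) g j (X j w) * g i (X i w))%:E)%E.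
  by apply: eq_integral => w _; rewrite (bigD1 i)//= mulrC.
rewrite (@integral_weighted_pushforward _ _ _ _ _ P (distribution P (X i)) (X i)
  (fun w => \prod_(j | j != i) g j (X j w)) c)//.
- rewrite ge0_integral_distribution//; last first.
  + by move=> y; rewrite lee_fin.
  + exact/measurable_EFinP.
  by rewrite /comp ge -EFinM mulrC [in RHS](bigD1 i).
- rewrite (_ : (fun w => _) = (fun w => \prod_(j <- [seq j <- index_enum 'I_m | j != i]) g j (X j w))); last first.
    by apply/funext => w; rewrite big_filter.
  by apply: measurable_prod => j _; apply: measurableT_comp.
- by move=> w; apply: prodr_ge0 => j _.
(* What remains is the indicator hypothesis of [integral_weighted_pushforward]: once factor [i] is
   replaced by [\1_B], the induction hypothesis applies. *)
move=> B mB.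
pose g' j := if j == i then (\1_B : R -> R) else g j.
pose e' j := if j == i then fine (P (X i @^-1` B)) else e j.
have mXB : measurable (X i @^-1` B).
  by rewrite -[X in measurable X]setTI; exact: measurable_funP.
have := IHn g' e'; rewrite (bigD1 i)//= [e' i]/e' eqxx.
rewrite (eq_bigr e); last by move=> j /negbTE ji; rewrite /e' ji.
rewrite mulrC EFinM fineK ?fin_num_measure// => <-.
- apply: eq_integral => w _; rewrite [in RHS](bigD1 i)//= mulrC /g' eqxx.
  by congr (_ * _)%:E; apply: eq_bigr => j /negbTE ->.
- by move=> j; rewrite /g'; case: eqP.
- by move=> j x; rewrite /g'; case: eqP => // _.
- move=> j; rewrite /g' /e'; have [->|_] := eqVneq j i => //.
  by rewrite fineK ?fin_num_measure// PE.
- move=> j nj; rewrite /g'; have [ji|ji] := eqVneq j i; first by exists B.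
  by apply: gB; rewrite ltn_neqAle nj andbT; apply: contraNneq ji => nj'; apply/eqP/val_inj.
Qed.

Lemma integral_prod_independent (g : 'I_m -> R -> R) (e : 'I_m -> R) :
  (forall j, measurable_fun setT (g j)) -> (forall j x, 0 <= g j x) ->
  (forall j, (\int[P]_w (g j (X j w))%:E = (e j)%:E)%E) ->
  (\int[P]_w (\prod_j g j (X j w))%:E = (\prod_j e j)%:E)%E.
Proof.
move=> mg g0 ge; apply: (integral_prod_mixed (n := m)) => // j.
by rewrite leqNgt ltn_ord.
Qed.

End IndependentProduct.

(** * Exponential bounds and Chernoff inequalities *)

Section ExpBounds.
Context {R : realType}.
Implicit Type u : R.

Lemma expRN_le u : 0 <= u <= 1 -> expR (- u) <= 1 - u / 2.
Proof.
move=> /andP[u0 u1]; rewrite expRN -[leRHS]invrK lef_pV2 ?posrE ?expR_gt0//.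
  apply: le_trans (expR_ge1Dx u); rewrite -div1r ler_pdivrMr; nra.
by rewrite invr_gt0; lra.
Qed.

(** Here [expR u <= 1 / (1 - u)], and [(1 - u) * (1 + u + 2 * u ^+ 2) = 1 + u ^+ 2 * (1 - 2 * u)] is
    at least 1. *)
Lemma expR_le_quadratic u : `|u| <= 2^-1 -> expR u <= 1 + u + 2 * u ^+ 2.
Proof.
rewrite ler_norml => /andP[u1 u2]; rewrite -[u in expR u]opprK expRN.
rewrite -[leRHS]invrK lef_pV2 ?posrE ?expR_gt0//; last by rewrite invr_gt0; nra.
apply: le_trans (expR_ge1Dx (- u)); rewrite -div1r ler_pdivrMr; nra.
Qed.

Lemma expR_le1D2x u : 0 <= u <= 2^-1 -> expR u <= 1 + 2 * u.
Proof.
move=> /andP[u0 u1]; apply: (le_trans (expR_le_quadratic _)); last by nra.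
by rewrite ger0_norm.
Qed.

(** The right-hand side is the square of [expR (u / 2) - expR (- (u / 2))], which is at least
    [u / 2] for [u >= 0]; evenness covers the other sign. *)
Lemma expRDN_ge u : u ^+ 2 / 4 <= expR u + expR (- u) - 2.
Proof.
wlog u0 : u / 0 <= u.
  move=> H; have [/H//|/ltW u0] := leP 0 u.
  by have := H (- u); rewrite oppr_ge0 sqrrN opprK [expR (- u) + _]addrC; apply.
have -> : expR u + expR (- u) - 2 = (expR (u / 2) - expR (- (u / 2))) ^+ 2.
  have h2 : u / 2 *+ 2 = u by rewrite -mulr_natr divfK.
  rewrite sqrrB -expRD subrr expR0 -!expRM_natl !mulr_natl mulNrn h2 //.
  by rewrite addrAC.
have h1 := expR_ge1Dx (u / 2).
have h2 : expR (- (u / 2)) <= 1 by rewrite -[leRHS]expR0 ler_expR; lra.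
have -> : u ^+ 2 / 4 = (u / 2) ^+ 2 by field.
by apply: lerXn2r; rewrite ?nnegrE; lra.
Qed.

Lemma half_le_ln2 : 2^-1 <= ln 2 :> R.
Proof.
rewrite -[2^-1]expRK ler_ln ?posrE ?expR_gt0//.
have h0 : 0 <= (2^-1 : R) by rewrite invr_ge0.
have := expR_le1D2x (introT andP (conj h0 (lexx (2^-1 : R)))); lra.
Qed.

End ExpBounds.

(** * Expectations of bounded measurable functions under the density *)

Section Population.
Context {R : realType}.
Variables (a b : R) (nu : R -> R).
Hypothesis hnu : probability_density a b nu.

Local Notation I := `[a, b]%classic.
Local Notation leb := (@lebesgue_measure R).

(** Conditions are imposed only on [[a, b]], where the density lives. The class is stable under ring
    operations and [expR], and it makes every integral against [nu] finite. *)
Definition bounded_measurable (g : R -> R) :=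
  measurable_fun I g /\ exists M, forall x, x \in `[a, b] -> `|g x| <= M.

Local Notation bm := bounded_measurable.

Definition pop (g : R -> R) : R := \int[leb]_(x in I) (g x * nu x).

Lemma bm_cst c : bm (fun=> c).
Proof. by split => //; exists `|c|. Qed.

Lemma bmD g h : bm g -> bm h -> bm (fun x => g x + h x).
Proof.
move=> [mg [M gM]] [mh [N hN]]; split; first exact: measurable_funD.
exists (M + N) => x xI; apply: le_trans (ler_normD _ _) _.
by apply: lerD; [exact: gM|exact: hN].
Qed.

Lemma bmM g h : bm g -> bm h -> bm (fun x => g x * h x).
Proof.
move=> [mg [M gM]] [mh [N hN]]; split; first exact: measurable_funM.
exists (M * N) => x xI; rewrite normrM.
by apply: ler_pM => //; [exact: gM|exact: hN].
Qed.

Lemma bmZ c g : bm g -> bm (fun x => c * g x).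
Proof. by move=> bg; apply: bmM => //; exact: bm_cst. Qed.

Lemma bmN g : bm g -> bm (fun x => - g x).
Proof.
by move=> bg; under eq_fun do rewrite -mulN1r; exact: bmZ.
Qed.

Lemma bmB g h : bm g -> bm h -> bm (fun x => g x - h x).
Proof. by move=> bg bh; apply: bmD => //; exact: bmN. Qed.

Lemma bmX g n : bm g -> bm (fun x => g x ^+ n).
Proof.
move=> bg; elim: n => [|n IHn]; first exact: bm_cst.
by under eq_fun do rewrite exprS; exact: bmM.
Qed.

Lemma bm_sum (J : Type) (r : seq J) (Q : pred J) (g : J -> R -> R) :
  (forall j, Q j -> bm (g j)) -> bm (fun x => \sum_(j <- r | Q j) g j x).
Proof.
move=> bg; elim: r => [|j r IHr].
  by under eq_fun do rewrite big_nil; exact: bm_cst.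
under eq_fun do rewrite big_cons; case: (boolP (Q j)) => // Qj.
by apply: bmD => //; exact: bg.
Qed.

Lemma bm_expR g : bm g -> bm (fun x => expR (g x)).
Proof.
move=> [mg [M gM]]; split; first exact: measurableT_comp.
exists (expR M) => x xI; rewrite ger0_norm ?expR_ge0// ler_expR.
exact: le_trans (ler_norm _) (gM _ xI).
Qed.

Lemma bm_le_cst (M : R) (g : R -> R) :
  measurable_fun I g -> (forall x, x \in `[a, b] -> 0 <= g x <= M) -> bm g.
Proof.
move=> mg gM; split => //; exists M => x xI.
by have /andP[g0 ?] := gM _ xI; rewrite ger0_norm.
Qed.

Lemma bm_horner (p : {poly R}) : bm (horner p).
Proof.
have -> : horner p = fun x => \sum_(i < size p) p`_i * x ^+ i.
  by apply/funext => x; rewrite horner_coef.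
apply: bm_sum => i _; apply: bmZ; apply: bmX; split => //.
exists (`|a| + `|b|) => x; rewrite in_itv/= => /andP[ax xb].
have := ler_norm b; have := ler_norm (- a); rewrite normrN => h1 h2.
have := normr_ge0 a; have := normr_ge0 b => h3 h4.
by rewrite ler_norml; apply/andP; split; lra.
Qed.

Let mI : measurable I. Proof. exact: measurable_itv. Qed.

Let nu0 x : I x -> 0 <= nu x.
Proof. by case: hnu => _ h _ ?; apply: h. Qed.

Let mnu : measurable_fun I nu. Proof. by case: hnu. Qed.

Lemma bm_integrable g : bm g -> leb.-integrable I (EFin \o (fun x => g x * nu x)).
Proof.
move=> [mg [M gM]]; apply/integrableP; split.
  by apply/measurable_EFinP; exact: measurable_funM.
apply: (@le_lt_trans _ _ (\int[leb]_(x in I) (`|M|%:E * (nu x)%:E))%E).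
  apply: ge0_le_integral => //.
  - by apply: measurableT_comp => //; apply/measurable_EFinP; exact: measurable_funM.
  - by apply/measurable_EFinP; apply: measurable_funM.
  - move=> x xI; rewrite /= lee_fin normrM (ger0_norm (nu0 xI)).
    by apply: ler_wpM2r; rewrite ?nu0// (le_trans (gM _ xI))// ler_norm.
rewrite ge0_integralZl//.
- by case: hnu => _ _ ->; rewrite mule1 ltry.
- exact/measurable_EFinP.
Qed.

Lemma pop_fineK g : bm g ->
  ((pop g)%:E = \int[leb]_(x in I) (g x * nu x)%:E)%E.
Proof.
by move=> bg; rewrite /pop /Rintegral fineK//; exact/integrable_fin_num/bm_integrable.
Qed.

Lemma eq_pop g h : (forall x, x \in `[a, b] -> g x = h x) -> pop g = pop h.
Proof. by move=> gh; apply: eq_Rintegral => x; rewrite inE => xI; rewrite gh. Qed.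

Lemma popD g h : bm g -> bm h -> pop (fun x => g x + h x) = pop g + pop h.
Proof.
move=> bg bh; rewrite /pop -RintegralD//; try exact: bm_integrable.
by apply: eq_Rintegral => x _; rewrite mulrDl.
Qed.

Lemma popZ c g : bm g -> pop (fun x => c * g x) = c * pop g.
Proof.
move=> bg; rewrite /pop -RintegralZl//; last exact: bm_integrable.
by apply: eq_Rintegral => x _; rewrite mulrA.
Qed.

Lemma popB g h : bm g -> bm h -> pop (fun x => g x - h x) = pop g - pop h.
Proof.
move=> bg bh; rewrite -mulN1r -popZ// -popD//; last exact: bmZ.
by apply: eq_pop => x _; rewrite mulN1r.
Qed.

Lemma pop_cst c : pop (fun=> c) = c.
Proof.
rewrite -[in LHS](mulr1 c) popZ; last exact: bm_cst.
rewrite (_ : pop _ = 1) ?mulr1//; apply: EFin_inj; rewrite pop_fineK; last exact: bm_cst.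
by under eq_integral do rewrite mul1r; case: hnu.
Qed.

Lemma le_pop g h : bm g -> bm h -> (forall x, x \in `[a, b] -> g x <= h x) ->
  pop g <= pop h.
Proof.
move=> bg bh gh; apply: le_Rintegral => //; try exact: bm_integrable.
by move=> x xI; apply: ler_wpM2r; [exact: nu0|exact: gh].
Qed.

Lemma pop_ge0 g : (forall x, x \in `[a, b] -> 0 <= g x) -> 0 <= pop g.
Proof. by move=> g0; apply: Rintegral_ge0 => x xI; rewrite mulr_ge0 ?g0 ?nu0. Qed.

Lemma pop_sum (J : Type) (r : seq J) (Q : pred J) (g : J -> R -> R) :
  (forall j, Q j -> bm (g j)) ->
  pop (fun x => \sum_(j <- r | Q j) g j x) = \sum_(j <- r | Q j) pop (g j).
Proof.
move=> bg; elim: r => [|j r IHr].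
  by rewrite big_nil -[RHS](pop_cst 0); apply: eq_pop => x _; rewrite big_nil.
rewrite big_cons -IHr; case: ifPn => Qj.
  rewrite -popD; [|exact: bg|exact: bm_sum].
  by apply: eq_pop => x _; rewrite big_cons Qj.
by apply: eq_pop => x _; rewrite big_cons (negbTE Qj).
Qed.

(** * Expectations and tail bounds for functions of the sample *)

Section Sampling.
Context {d : measure_display} {T : measurableType d}.
Variable P : probability T R.

(** Since [nu] is controlled only on [[a, b]], its extension by zero serves as the weight of a
    pushforward along the identity. *)
Lemma integral_has_density (X : {RV P >-> R}) (g : R -> R) :
  has_density a b nu X ->
  measurable_fun setT g -> (forall x, 0 <= g x) -> bm g ->
  (\int[P]_w (g (X w))%:E = (pop g)%:E)%E.
Proof.
move=> hX mg g0 bg.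
have h0 x : 0 <= (nu \_ I) x.
  by rewrite patchE; case: ifPn => // /set_mem; exact: nu0.
have mh : measurable_fun setT (nu \_ I).
  by apply/(measurable_restrict _ mI measurableT); rewrite ?setTI//.
have patchM k x : (nu \_ I) x * k x = ((fun x => k x * nu x) \_ I) x.
  by rewrite !patchE; case: ifP; rewrite ?mul0r// mulrC.
transitivity (\int[distribution P X]_y (g y)%:E)%E.
  by rewrite ge0_integral_distribution//; exact/measurable_EFinP.
have : (\int[leb]_t ((nu \_ I) t * g t)%:E =
    1%:E * \int[distribution P X]_y (g y)%:E)%E.
  apply: (@integral_weighted_pushforward R _ _ _ _ leb (distribution P X) id (nu \_ I) 1) => // B mB.
  rewrite mul1e; transitivity (\int[leb]_(x in B `&` I) (nu x)%:E)%E; last first.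
    by rewrite -hX.
  rewrite [RHS]integral_mkcond; apply: eq_integral => x _ /=.
  rewrite !patchE indicE in_setI andbC.
  by case: (x \in I); case: (x \in B); rewrite /= ?mulr1 ?mulr0 ?mul0r.
rewrite mul1e => <-.
rewrite pop_fineK// [RHS]integral_mkcond; apply: eq_integral => x _ /=.
by rewrite patchM restrict_EFin.
Qed.

Lemma has_density_as_in (X : {RV P >-> R}) :
  has_density a b nu X -> P (X @^-1` ~` I) = 0%E.
Proof.
move=> hX; have mXI : measurable (X @^-1` I).
  by rewrite -[Y in measurable Y]setTI; exact: measurable_funP.
rewrite preimage_setC probability_setC//.
have -> : P (X @^-1` I) = 1%E by have := hX I mI; rewrite setIid; case: hnu => _ _ ->.
by rewrite subee.
Qed.

Lemma markov_expectation (A : set T) (F : T -> R) (t e : R) :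
  measurable A -> measurable_fun setT F -> (forall w, 0 <= F w) -> 0 < t ->
  (forall w, A w -> t <= F w) -> (\int[P]_w (F w)%:E = e%:E)%E ->
  (P A <= (e / t)%:E)%E.
Proof.
move=> mA mF F0 t0 AF Fe.
rewrite EFinM [leRHS]muleC -[leLHS]mul1e -(mulVf (lt0r_neq0 t0)) EFinM -muleA.
apply: lee_wpmul2l; first by rewrite lee_fin invr_ge0 ltW.
have -> : P A = (\int[P]_w (\1_A w)%:E)%E by rewrite integral_indic// setIT.
rewrite -Fe -ge0_integralZl//.
- apply: ge0_le_integral => //.
  + by move=> w _; rewrite -EFinM lee_fin mulr_ge0// ltW.
  + by apply/measurable_EFinP; apply: measurable_funM.
  + exact/measurable_EFinP.
  + move=> w _; rewrite -EFinM lee_fin indicE; case: (boolP (w \in A)) => [/set_mem Aw|_].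
      by rewrite mulr1 AF.
    by rewrite mulr0.
- exact/measurable_EFinP.
- by rewrite lee_fin ltW.
Qed.

Variables (m : nat) (X : 'I_m -> {RV P >-> R}).
Hypotheses (indep : mutually_independent X) (dens : forall j, has_density a b nu (X j)).

Lemma measurable_sum_sample (g : R -> R) : measurable_fun setT g ->
  measurable_fun setT (fun w => \sum_j g (X j w)).
Proof. by move=> mg; apply: measurable_sum => j; exact: measurableT_comp. Qed.

(** Exponential Markov inequality: by independence the exponential moment of the sum is a product of
    [m] equal factors, each at most [expR e]. *)
Lemma chernoff (g : R -> R) (e t : R) :
  measurable_fun setT g -> bm g -> pop (fun x => expR (g x)) <= expR e ->
  (P [set w | t <= \sum_j g (X j w)]%R <= (expR (m%:R * e - t))%:E)%E.
Proof.
move=> mg bg ge.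
have mE : measurable_fun setT (fun x => expR (g x)) by exact: measurableT_comp.
have mS := measurable_sum_sample mg.
apply: (le_trans (@markov_expectation _ (fun w => expR (\sum_j g (X j w)))
   (expR t) (\prod_(j < m) pop (fun x => expR (g x))) _ _ _ _ _ _)).
- rewrite -[Y in measurable Y]setTI; apply: measurable_fun_le => //.
- exact: measurableT_comp.
- by move=> w; exact: expR_ge0.
- exact: expR_gt0.
- by move=> w /= tw; rewrite ler_expR.
- rewrite -(@integral_prod_independent _ _ _ P m X indep (fun _ x => expR (g x))
    (fun=> pop (fun x => expR (g x))))//.
  + by apply: eq_integral => w _; rewrite expR_sum.
  + move=> j; apply: (integral_has_density (dens j)) => //; exact: bm_expR.
rewrite lee_fin prodr_const card_ord expRD expRN ler_pM2r ?invr_gt0 ?expR_gt0//.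
rewrite expRM_natl; apply: lerXn2r => //; rewrite nnegrE ?expR_ge0//.
by apply: pop_ge0 => x _; exact: expR_ge0.
Qed.

Definition emp (x : 'I_m -> R) (g : R -> R) : R := m%:R^-1 * \sum_j g (x j).

Hypothesis m0 : (0 < m)%N.

Let mR0 : 0 < m%:R :> R. Proof. by rewrite ltr0n. Qed.

(** At parameter [1 / M], [expRN_le] bounds the exponential moment by [1 - pop g / (2 * M)]. Giving
    up half of the mean makes the failure probability depend only on [m], the slack [beta] and the
    range [M]. *)
Lemma chernoff_lower (g : R -> R) (M beta : R) :
  measurable_fun setT g -> 0 < M -> (forall x, x \in `[a, b] -> 0 <= g x <= M) ->
  (P [set w | emp (X ^~ w) g <= pop g / 2 - beta]%R <=
    (expR (- (m%:R * beta / M)))%:E)%E.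
Proof.
move=> mg M0 gM; have bg : bm g by apply: (bm_le_cst (M := M)) => //; exact: measurable_funTS.
have := @chernoff (fun x => - (g x / M)) (- (pop g / (2 * M)))
  (- (m%:R * (pop g / 2 - beta) / M)).
rewrite (_ : m%:R * _ - _ = - (m%:R * beta / M)); last by field; rewrite lt0r_neq0.
have -> : [set w | - (m%:R * (pop g / 2 - beta) / M) <= \sum_j - (g (X j w) / M)] =
    [set w | emp (X ^~ w) g <= pop g / 2 - beta].
  apply/seteqP; split => w /=; rewrite /emp sumrN lerN2 -mulr_suml ler_pM2r ?invr_gt0//;
  by rewrite -ler_pdivrMl.
apply.
- by apply: measurableT_comp => //; apply: measurable_funM.
- by apply: bmN; apply: bmM => //; exact: bm_cst.
have -> : - (pop g / (2 * M)) = - ((2 * M)^-1 * pop g) by rewrite mulrC.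
apply: le_trans (expR_ge1Dx _).
rewrite -popZ// -[X in _ <= X + _](pop_cst 1) -popB; [|exact: bm_cst|exact: bmZ].
apply: le_pop.
- by apply: bm_expR; apply: bmN; apply: bmM => //; exact: bm_cst.
- by apply: bmB; [exact: bm_cst|exact: bmZ].
move=> x /gM /andP[g0 gMx]; apply: le_trans (expRN_le _) _.
  by rewrite divr_ge0 ?(ltW M0)//= ler_pdivrMr// mul1r.
by rewrite le_eqVlt; apply/orP; left; apply/eqP; field; rewrite lt0r_neq0.
Qed.

(** Parameter [1 / (2 * M)] keeps the exponent in the range [[0, 1/2]] of [expR_le1D2x]; the price
    is the factor 2 on the mean. *)
Lemma chernoff_upper (g : R -> R) (M beta : R) :
  measurable_fun setT g -> 0 < M -> (forall x, x \in `[a, b] -> 0 <= g x <= M) ->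
  (P [set w | 2 * pop g + beta <= emp (X ^~ w) g]%R <=
    (expR (- (m%:R * beta / (2 * M))))%:E)%E.
Proof.
move=> mg M0 gM; have bg : bm g by apply: (bm_le_cst (M := M)) => //; exact: measurable_funTS.
have := @chernoff (fun x => g x / (2 * M)) (pop g / M)
  (m%:R * (2 * pop g + beta) / (2 * M)).
rewrite (_ : m%:R * _ - _ = - (m%:R * beta / (2 * M))); last by field; rewrite lt0r_neq0.
have -> : [set w | m%:R * (2 * pop g + beta) / (2 * M) <= \sum_j (g (X j w) / (2 * M))] =
    [set w | 2 * pop g + beta <= emp (X ^~ w) g].
  apply/seteqP; split => w /=; rewrite /emp -mulr_suml ler_pM2r ?invr_gt0 ?mulr_gt0//;
  by rewrite ler_pdivlMl.
apply.
- by apply: measurable_funM.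
- by apply: bmM => //; exact: bm_cst.
have -> : pop g / M = M^-1 * pop g by rewrite mulrC.
apply: le_trans (expR_ge1Dx _).
rewrite -popZ// -[X in _ <= X + _](pop_cst 1) -popD; [|exact: bm_cst|exact: bmZ].
apply: le_pop.
- by apply: bm_expR; apply: bmM => //; exact: bm_cst.
- by apply: bmD; [exact: bm_cst|exact: bmZ].
move=> x /gM /andP[g0 gMx]; apply: le_trans (expR_le1D2x _) _.
  rewrite divr_ge0 ?mulr_ge0 ?(ltW M0)//= ler_pdivrMr ?mulr_gt0//.
  by rewrite mulrA mulVf ?mul1r.
by rewrite le_eqVlt; apply/orP; left; apply/eqP; field; rewrite lt0r_neq0.
Qed.

End Sampling.

End Population.

(** * Maurey's empirical method *)

Section Maurey.
Context {R : realType}.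

(** This is [2 cosh (lam u) - 2]. One potential dominates both the squared error, as the truncated
    part requires, and the indicator of a large error, as the levels require. *)
Definition cosh_excess (lam u : R) : R := expR (lam * u) + expR (- (lam * u)) - 2.

Lemma cosh_excess_ge (lam u : R) : (lam * u) ^+ 2 / 4 <= cosh_excess lam u.
Proof. exact: expRDN_ge. Qed.

Lemma cosh_excess_ge0 (lam u : R) : 0 <= cosh_excess lam u.
Proof. by apply: le_trans (cosh_excess_ge lam u); rewrite divr_ge0// sqr_ge0. Qed.

(** Convexity of the exponential between [0] and [x]: the combination with weights [1 - t] and [t]
    of its tangent bounds at [t * x]. *)
Lemma expRM_sub1_le (t x : R) : 0 <= t <= 1 -> expR (t * x) - 1 <= t * (expR x - 1).
Proof.
move=> /andP[t0 t1].
have e0 := expR_gt0 (t * x).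
have h1 : expR (t * x) * (1 + (1 - t) * x) <= expR x.
  rewrite -[in leRHS](_ : t * x + (1 - t) * x = x); last by ring.
  by rewrite expRD ler_pM2l// expR_ge1Dx.
have h2 : expR (t * x) * (1 - t * x) <= 1.
  by rewrite -[leRHS](expRxMexpNx_1 (t * x)) ler_pM2l// expR_ge1Dx.
have h3 : t * (expR (t * x) * (1 + (1 - t) * x)) <= t * expR x by rewrite ler_wpM2l.
have h4 : (1 - t) * (expR (t * x) * (1 - t * x)) <= 1 - t.
  by rewrite -[leRHS]mulr1 ler_wpM2l// subr_ge0.
have -> : expR (t * x) = t * (expR (t * x) * (1 + (1 - t) * x))
    + (1 - t) * (expR (t * x) * (1 - t * x)) by ring.
lra.
Qed.

Variables (T : finType) (p : T -> R).
Hypotheses (p0 : forall t, 0 <= p t) (p1 : \sum_t p t = 1).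

Let pavg (g : T -> R) := \sum_t p t * g t.

Lemma pavg_norm_le (g : T -> R) (B : R) : (forall t, `|g t| <= B) -> `|pavg g| <= B.
Proof.
move=> gB; apply: le_trans (ler_norm_sum _ _ _) _.
rewrite -[leRHS]mul1r -p1 mulr_suml; apply: ler_sum => t _.
by rewrite normrM ger0_norm// ler_wpM2l.
Qed.

Lemma pavg_sqr_le (g : T -> R) (B : R) : (forall t, `|g t| <= B) ->
  0 <= pavg (fun t => g t ^+ 2) <= B ^+ 2.
Proof.
move=> gB; apply/andP; split; first by apply: sumr_ge0 => t _; rewrite mulr_ge0 ?sqr_ge0.
rewrite -[leRHS]mul1r -p1 mulr_suml; apply: ler_sum => t _.
rewrite ler_wpM2l// -real_normK ?num_real// lerXn2r// nnegrE.
exact: le_trans (gB t).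
Qed.

(** The law of [k] independent draws from [p], kept finite so that Maurey's random choice is a plain
    weighted sum. *)
Definition sample_weight k (w : {ffun 'I_k -> T}) : R := \prod_i p (w i).

Definition sample_mean k (g : T -> R) (w : {ffun 'I_k -> T}) : R :=
  k%:R^-1 * \sum_i g (w i).

Lemma sample_weight_ge0 k (w : {ffun 'I_k -> T}) : 0 <= sample_weight w.
Proof. exact: prodr_ge0. Qed.

Lemma sum_sample_weight k : \sum_(w : {ffun 'I_k -> T}) sample_weight w = 1.
Proof.
transitivity (\prod_(i < k) \sum_t p t).
  by rewrite bigA_distr_bigA.
by rewrite big1.
Qed.

(** The exponential factors over the draws. Each factor has a centred exponent, at most 1/2 in
    absolute value because [4 * |lam| * B <= k], so the quadratic bound on [expR] leaves only a
    variance, which the second moment dominates. *)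
Lemma sample_mean_mgf k (g : T -> R) (B lam : R) :
  (0 < k)%N -> (forall t, `|g t| <= B) -> 4 * `|lam| * B <= k%:R ->
  \sum_(w : {ffun 'I_k -> T}) sample_weight w * expR (lam * (pavg g - sample_mean g w))
  <= expR (2 * lam ^+ 2 * pavg (fun t => g t ^+ 2) / k%:R).
Proof.
move=> k0 gB lamB; have kR0 : 0 < k%:R :> R by rewrite ltr0n.
pose u t := lam / k%:R * (pavg g - g t).
have -> : \sum_(w : {ffun 'I_k -> T}) sample_weight w * expR (lam * (pavg g - sample_mean g w)) =
    \prod_(i < k) \sum_t p t * expR (u t).
  rewrite bigA_distr_bigA; apply: eq_bigr => w _; rewrite big_split/=; congr (_ * _).
  rewrite -expR_sum; congr expR; rewrite -mulr_sumr sumrB sumr_const card_ord.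
  by rewrite /sample_mean -mulr_natl; field; rewrite lt0r_neq0.
rewrite prodr_const card_ord.
have avg1 : \sum_t p t * expR (u t) <=
    expR (2 * (lam / k%:R) ^+ 2 * pavg (fun t => g t ^+ 2)).
  apply: le_trans (expR_ge1Dx _).
  apply: (@le_trans _ _ (\sum_t p t * (1 + u t + 2 * u t ^+ 2))).
    apply: ler_sum => t _; rewrite ler_wpM2l// expR_le_quadratic//.
    rewrite /u normrM normf_div [`|k%:R|]ger0_norm; last exact: ltW.
    have : `|pavg g - g t| <= 2 * B.
      apply: le_trans (ler_normB _ _) _.
      by have := pavg_norm_le gB; have := gB t; lra.
    move=> h; apply: (@le_trans _ _ (`|lam| / k%:R * (2 * B))).
      by rewrite ler_wpM2l// divr_ge0// ltW.
    rewrite mulrAC ler_pdivrMr//; lra.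
  have avgu : \sum_t p t * u t = 0.
    rewrite /u; under eq_bigr do rewrite mulrCA mulrBr.
    by rewrite -mulr_sumr sumrB -mulr_suml p1 mul1r subrr mulr0.
  have -> : \sum_t p t * (1 + u t + 2 * u t ^+ 2) = 1 + 2 * \sum_t p t * u t ^+ 2.
    under eq_bigr do rewrite !mulrDr mulr1.
    by rewrite !big_split/= p1 avgu addr0 mulr_sumr; congr (_ + _); apply: eq_bigr => t _; ring.
  rewrite lerD2l -mulrA ler_pM2l//.
  under eq_bigr do rewrite /u exprMn mulrCA.
  rewrite -mulr_sumr ler_wpM2l ?sqr_ge0//.
  have -> : \sum_t p t * (pavg g - g t) ^+ 2 = pavg (fun t => g t ^+ 2) - pavg g ^+ 2.
    rewrite (eq_bigr (fun t => p t * pavg g ^+ 2 - 2 * pavg g * (p t * g t) +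
      p t * g t ^+ 2)); last by move=> t _; ring.
    rewrite !big_split/= sumrN -mulr_suml p1 -mulr_sumr -/(pavg g) -/(pavg _).
    by ring.
  by rewrite gerBl sqr_ge0.
have -> : 2 * lam ^+ 2 * pavg (fun t => g t ^+ 2) / k%:R =
    k%:R * (2 * (lam / k%:R) ^+ 2 * pavg (fun t => g t ^+ 2)).
  by field; rewrite lt0r_neq0.
rewrite expRM_natl lerXn2r// nnegrE ?expR_ge0//.
by apply: sumr_ge0 => t _; rewrite mulr_ge0// expR_ge0.
Qed.

(** The bounds for [lam] and [- lam] are added. Convexity, with interpolation weight [v / B ^+ 2],
    then makes the result linear in the second moment [v]. *)
Lemma sample_mean_cosh_excess k (g : T -> R) (B lam : R) :
  (0 < k)%N -> 0 < B -> (forall t, `|g t| <= B) -> 4 * `|lam| * B <= k%:R ->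
  \sum_(w : {ffun 'I_k -> T}) sample_weight w * cosh_excess lam (pavg g - sample_mean g w)
  <= 2 * (expR (2 * lam ^+ 2 * B ^+ 2 / k%:R) - 1) / B ^+ 2 * pavg (fun t => g t ^+ 2).
Proof.
move=> k0 B0 gB lamB.
have H1 := sample_mean_mgf k0 gB lamB.
have := @sample_mean_mgf k g B (- lam) k0 gB; rewrite normrN => /(_ lamB) H2.
have /andP[v0 vB] := pavg_sqr_le gB.
set v := pavg (fun t => g t ^+ 2) in H1 H2 v0 vB *.
apply: (@le_trans _ _ (2 * (expR (2 * lam ^+ 2 * v / k%:R) - 1))).
  under eq_bigr do rewrite /cosh_excess mulrBr mulrDr.
  rewrite sumrB big_split/= -mulr_suml sum_sample_weight.
  move: H2; rewrite sqrrN [X in X <= _ -> _](eq_bigr (fun w : {ffun 'I_k -> T} =>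
    sample_weight w * expR (- (lam * (pavg g - sample_mean g w))))); last first.
    by move=> w _; rewrite mulNr.
  by move=> H2; lra.
have t1 : 0 <= v / B ^+ 2 <= 1.
  by rewrite divr_ge0 ?sqr_ge0//= ler_pdivrMr ?mul1r// exprn_gt0.
have := expRM_sub1_le (2 * lam ^+ 2 * B ^+ 2 / k%:R) t1.
rewrite (_ : v / B ^+ 2 * _ = 2 * lam ^+ 2 * v / k%:R); last first.
  by field; rewrite !lt0r_neq0// ltr0n.
move=> H; rewrite [leRHS](_ : _ =
  2 * (v / B ^+ 2 * (expR (2 * lam ^+ 2 * B ^+ 2 / k%:R) - 1))); last by ring.
by rewrite ler_pM2l.
Qed.

(** If every [Phi j] exceeded [c], the nonnegative terms [W j * (Phi j - c)] would have sum at most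
    zero, so all weights would vanish. *)
Lemma exists_le_weighted_sum (J : finType) (W Phi : J -> R) (c : R) :
  (forall j, 0 <= W j) -> \sum_j W j = 1 -> \sum_j W j * Phi j <= c ->
  exists j, Phi j <= c.
Proof.
move=> W0 W1 Wc; apply/not_existsP => H.
have Phic j : 0 <= W j * (Phi j - c).
  by rewrite mulr_ge0// subr_ge0 ltW// ltNge; apply/negP/H.
have S0 : \sum_j W j * (Phi j - c) = 0.
  apply/eqP; rewrite eq_le sumr_ge0// andbT.
  by under eq_bigr do rewrite mulrBr; rewrite sumrB -mulr_suml W1 mul1r subr_le0.
suff : \sum_j W j = 0 by rewrite W1 => /eqP; rewrite oner_eq0.
apply: big1 => j _; have /eqP := psumr_eq0P (fun j _ => Phic j) S0 (i := j) isT.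
rewrite mulf_eq0 => /orP[/eqP//|]; rewrite subr_eq0 => /eqP Pj.
by exfalso; apply: (H j); rewrite Pj.
Qed.

Variables (a b : R) (nu : R -> R).
Hypothesis hnu : probability_density a b nu.

Lemma emp_ge0 m (x : 'I_m -> R) (g : R -> R) : (forall j, 0 <= g (x j)) -> 0 <= emp x g.
Proof. by move=> g0; rewrite mulr_ge0 ?invr_ge0 ?sumr_ge0. Qed.

Lemma le_emp m (x : 'I_m -> R) (g h : R -> R) :
  (forall j, g (x j) <= h (x j)) -> emp x g <= emp x h.
Proof. by move=> gh; rewrite ler_wpM2l ?invr_ge0 ?ler_sum. Qed.

Lemma empD m (x : 'I_m -> R) (g h : R -> R) :
  emp x (fun y => g y + h y) = emp x g + emp x h.
Proof. by rewrite /emp big_split mulrDr. Qed.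

Lemma empZ m (x : 'I_m -> R) c (g : R -> R) : emp x (fun y => c * g y) = c * emp x g.
Proof. by rewrite /emp -mulr_sumr mulrCA. Qed.

Lemma emp_sum m (x : 'I_m -> R) (J : Type) (r : seq J) (Q : pred J) (g : J -> R -> R) :
  emp x (fun y => \sum_(j <- r | Q j) g j y) = \sum_(j <- r | Q j) emp x (g j).
Proof. by rewrite /emp exchange_big/= mulr_sumr. Qed.

(* The same [w] serves [nu] and the sample: their two errors are added before averaging. *)
Lemma maurey k m (x : 'I_m -> R) (g : T -> R -> R) (B Q lam : R) :
  (0 < k)%N -> 0 < B -> (forall t, bounded_measurable a b (g t)) ->
  (forall j, x j \in `[a, b]) ->
  (forall t y, y \in `[a, b] -> `|g t y| <= B) ->
  (forall t, pop a b nu (fun y => g t y ^+ 2) + emp x (fun y => g t y ^+ 2) <= Q) ->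
  4 * `|lam| * B <= k%:R ->
  exists w : {ffun 'I_k -> T},
    pop a b nu (fun y => cosh_excess lam (pavg (g ^~ y) - sample_mean (g ^~ y) w)) +
    emp x (fun y => cosh_excess lam (pavg (g ^~ y) - sample_mean (g ^~ y) w)) <=
    2 * (expR (2 * lam ^+ 2 * B ^+ 2 / k%:R) - 1) / B ^+ 2 * Q.
Proof.
move=> k0 B0 bg xI gB gQ lamB.
set c := 2 * (expR _ - 1) / B ^+ 2.
have c0 : 0 <= c.
  rewrite divr_ge0 ?sqr_ge0// mulr_ge0// subr_ge0 -[leLHS]expR0 ler_expR.
  by rewrite divr_ge0// mulr_ge0 ?sqr_ge0// mulr_ge0 ?sqr_ge0.
pose E (w : {ffun 'I_k -> T}) y :=
  cosh_excess lam (pavg (g ^~ y) - sample_mean (g ^~ y) w).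
have bE w : bounded_measurable a b (E w).
  have bd : bounded_measurable a b (fun y => pavg (g ^~ y) - sample_mean (g ^~ y) w).
    apply: bmB; first by apply: bm_sum => t _; exact: bmZ.
    by apply: bmZ; apply: bm_sum.
  apply: bmB; last exact: bm_cst.
  by apply: bmD; apply: bm_expR; [|apply: bmN]; exact: bmZ.
(* Being linear in the second moment at [y], this estimate survives both integration under [nu] and
   averaging over the sample. *)
have Ec y : y \in `[a, b] ->
    \sum_w sample_weight w * E w y <= c * pavg (fun t => g t y ^+ 2).
  by move=> yI; apply: sample_mean_cosh_excess => // t; exact: gB.
apply: (@exists_le_weighted_sum _ (@sample_weight k)) => //.
- exact: sample_weight_ge0.
- exact: sum_sample_weight.
under eq_bigr do rewrite mulrDr.
rewrite big_split/=.
have bv : bounded_measurable a b (fun y => pavg (fun t => g t y ^+ 2)).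
  by apply: bm_sum => t _; apply: bmZ; exact: bmX.
have -> : \sum_(w : {ffun 'I_k -> T}) sample_weight w * pop a b nu (E w) =
    pop a b nu (fun y => \sum_w sample_weight w * E w y).
  rewrite pop_sum//; last by move=> w _; exact: bmZ.
  by apply: eq_bigr => w _; rewrite popZ.
have -> : \sum_(w : {ffun 'I_k -> T}) sample_weight w * emp x (E w) =
    emp x (fun y => \sum_w sample_weight w * E w y).
  by rewrite emp_sum; apply: eq_bigr => w _; rewrite empZ.
apply: (@le_trans _ _ (pop a b nu (fun y => c * pavg (fun t => g t y ^+ 2)) +
    emp x (fun y => c * pavg (fun t => g t y ^+ 2)))).
  apply: lerD; last by apply: le_emp => j; exact: Ec.
  apply: le_pop => //; last exact: bmZ.
  by apply: bm_sum => w _; exact: bmZ.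
rewrite popZ// empZ -mulrDr ler_wpM2l//.
rewrite pop_sum//; last by move=> t _; apply: bmZ; exact: bmX.
rewrite emp_sum -big_split/= -[leRHS]mul1r -p1 mulr_suml; apply: ler_sum => t _.
by rewrite popZ ?empZ -?mulrDr ?ler_wpM2l//; exact: bmX.
Qed.

End Maurey.

(** * Points of an [l_1] ball as averages of signed atoms *)

Section SignedDictionary.
Context {R : realType}.
Variables (n : nat) (r : R) (z : 'I_n.+1 -> R).
Hypotheses (r0 : 0 < r) (zr : \sum_i `|z i| <= r).

(* The defect [r - ||z||_1] is spread evenly, where its two signs cancel. *)
Definition signed_weight (t : 'I_n.+1 * bool) : R :=
  (`|z t.1| + (-1) ^+ t.2 * z t.1) / (2 * r) +
  (1 - (\sum_i `|z i|) / r) / (2 * n.+1%:R).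

Lemma signed_weight_ge0 t : 0 <= signed_weight t.
Proof.
rewrite addr_ge0// divr_ge0 ?mulr_ge0 ?(ltW r0)//.
  have := ler_norm (z t.1); have := ler_norm (- z t.1); rewrite normrN.
  by move=> h1 h2; case: t.2; rewrite /= ?expr1 ?expr0; lra.
by rewrite subr_ge0 ler_pdivrMr// mul1r.
Qed.

Lemma sum_signed_weight : \sum_t signed_weight t = 1.
Proof.
rewrite -(pair_bigA _ (fun i s => signed_weight (i, s)))/=.
have r0' := lt0r_neq0 r0.
rewrite (eq_bigr (fun i => `|z i| / r + (1 - (\sum_i `|z i|) / r) / n.+1%:R)); last first.
  move=> i _; rewrite big_bool /signed_weight/= expr0 expr1.
  by field; rewrite r0' nat1r pnatr_eq0.
rewrite big_split/= -mulr_suml sumr_const card_ord -[X in _ + X]mulr_natl.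
by field; rewrite r0' nat1r pnatr_eq0.
Qed.

Lemma signed_weight_mean (psi : 'I_n.+1 -> R) :
  \sum_t signed_weight t * (r * ((-1) ^+ t.2 * psi t.1)) = \sum_i z i * psi i.
Proof.
rewrite -(pair_bigA _ (fun i s => signed_weight (i, s) * (r * ((-1) ^+ s * psi i))))/=.
apply: eq_bigr => i _; rewrite big_bool /signed_weight/= expr0 expr1.
by field; rewrite (lt0r_neq0 r0) nat1r pnatr_eq0.
Qed.

End SignedDictionary.

(** * Comparing population and sample averages through a net *)

Section Dyadic.
Context {R : realType}.
Implicit Types (u v K tau : R) (L : nat).

Definition trunc_sqr K u : R := Num.min (u ^+ 2) (K ^+ 2).

Definition exceeds tau u : R := (tau < `|u|)%R%:R.

Lemma exceeds_ge0 tau u : 0 <= exceeds tau u. Proof. exact: ler0n. Qed.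

Lemma exceeds_le1 tau u : exceeds tau u <= 1. Proof. by rewrite lern1 leq_b1. Qed.

Lemma trunc_sqr_ge0 K u : 0 <= trunc_sqr K u.
Proof. by rewrite le_min !sqr_ge0. Qed.

Lemma measurable_trunc_sqr K : measurable_fun setT (trunc_sqr K).
Proof. by apply: measurable_minr => //; exact: measurable_funX. Qed.

Lemma measurable_exceeds tau : measurable_fun setT (exceeds tau).
Proof.
rewrite (_ : exceeds tau = \1_[set u | tau < `|u|]); last first.
  by apply/funext => u; rewrite indicE /exceeds; congr (_%:R); congr nat_of_bool;
    apply/idP/idP; rewrite inE.
apply: measurable_indic.
rewrite (_ : [set u | _] = ~` [set u | `|u| <= tau]); last first.
  by apply/seteqP; split => u /=; rewrite ltNge => /negP.
apply: measurableC; rewrite -[X in measurable X]setTI.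
exact: measurable_fun_le.
Qed.

(** If [u ^+ 2 <= K ^+ 2] this rests on [(2 * u - v) ^+ 2 >= 0]; otherwise the truncation level
    [K ^+ 2] alone bounds the left side. *)
Lemma trunc_sqr_quasi K u v : trunc_sqr K v <= 2 * trunc_sqr K u + 2 * (u - v) ^+ 2.
Proof.
have h0 : 0 <= (u - v) ^+ 2 := sqr_ge0 _.
have hK : 0 <= K ^+ 2 := sqr_ge0 _.
rewrite /trunc_sqr; case: (leP (u ^+ 2) (K ^+ 2)) => _; rewrite ge_min; apply/orP.
  by left; have := sqr_ge0 (2 * u - v); nra.
by right; lra.
Qed.

(** Only the highest threshold passed matters: if [K * 2 ^+ l] is exceeded and its double is not,
    the term of index [l] alone bounds [u ^+ 2]. *)
Lemma sqr_le_dyadic K L u : 0 < K -> `|u| <= K * 2 ^+ L ->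
  u ^+ 2 <= trunc_sqr K u +
    \sum_(l < L) 4 * (K * 2 ^+ l) ^+ 2 * exceeds (K * 2 ^+ l) u.
Proof.
move=> K0; elim: L => [|L IHL] uL.
  rewrite big_ord0 addr0 /trunc_sqr le_min lexx/= -real_normK ?num_real//.
  by rewrite lerXn2r// ?nnegrE ?(ltW K0)// (le_trans uL)// expr0 mulr1.
rewrite big_ord_recr/=; have [uL'|uL'] := leP `|u| (K * 2 ^+ L).
  apply: (le_trans (IHL uL')); rewrite addrA lerDl mulr_ge0 ?exceeds_ge0//.
  by rewrite mulr_ge0 ?sqr_ge0.
have h1 : u ^+ 2 <= 4 * (K * 2 ^+ L) ^+ 2.
  have -> : 4 * (K * 2 ^+ L) ^+ 2 = (K * 2 ^+ L.+1) ^+ 2 by rewrite [2 ^+ L.+1]exprS; ring.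
  by rewrite -real_normK ?num_real// lerXn2r// nnegrE// mulr_ge0 ?exprn_ge0// ltW.
have h2 : 0 <= \sum_(l < L) 4 * (K * 2 ^+ l) ^+ 2 * exceeds (K * 2 ^+ l) u.
  by rewrite sumr_ge0// => l _; rewrite mulr_ge0 ?exceeds_ge0 // mulr_ge0 ?sqr_ge0.
have h3 := trunc_sqr_ge0 K u.
have -> : exceeds (K * 2 ^+ L) u = 1 by rewrite /exceeds uL'.
lra.
Qed.

Lemma sum_pow4_le L : \sum_(l < L) (4 : R) ^+ l <= 4 ^+ L / 3.
Proof.
elim: L => [|L IHL]; first by rewrite big_ord0 expr0; lra.
by rewrite big_ord_recr/= [4 ^+ L.+1]exprS; lra.
Qed.

(** The active terms grow geometrically, so their sum is at most 4/3 of the last one, which is at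
    most [4 * u ^+ 2]. The thresholds are halved because the two passages between a function and its
    net approximation each lower them. *)
Lemma dyadic_le_sqr K L u : 0 < K ->
  \sum_(l < L) (K * 2 ^+ l) ^+ 2 * exceeds (K * 2 ^+ l / 2) u <= 16 / 3 * u ^+ 2.
Proof.
move=> K0; elim: L => [|L IHL]; first by rewrite big_ord0 mulr_ge0 ?sqr_ge0.
rewrite big_ord_recr/= /exceeds; have [Lu|_] := ltP (K * 2 ^+ L / 2) `|u|; last first.
  by rewrite mulr0 addr0.
have S : \sum_(l < L) (K * 2 ^+ l) ^+ 2 * exceeds (K * 2 ^+ l / 2) u <= (K * 2 ^+ L) ^+ 2 / 3.
  apply: (@le_trans _ _ (\sum_(l < L) K ^+ 2 * 4 ^+ l)).
    apply: ler_sum => l _; rewrite -[leRHS]mulr1 exprMn -exprM mulnC exprM.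
    rewrite (_ : 2 ^+ 2 = 4 :> R); last by rewrite expr2; lra.
    by rewrite ler_wpM2l ?exceeds_le1// mulr_ge0 ?sqr_ge0 ?exprn_ge0.
  rewrite -mulr_sumr exprMn -exprM mulnC exprM.
  rewrite (_ : 2 ^+ 2 = 4 :> R); last by rewrite expr2; lra.
  by rewrite -[leRHS]mulrA ler_wpM2l ?sqr_ge0// sum_pow4_le.
have : (K * 2 ^+ L / 2) ^+ 2 <= u ^+ 2.
  rewrite -[u ^+ 2]real_normK ?num_real// lerXn2r// ?nnegrE ?(ltW Lu)//.
  by rewrite divr_ge0// mulr_ge0 ?exprn_ge0// ltW.
rewrite expr_div_n mulr1 => h; rewrite /exceeds in S.
by have e4 : (2 : R) ^+ 2 = 4 by [rewrite expr2; lra]; rewrite e4 in h; lra.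
Qed.

Lemma expRN_nat_le (n : nat) : expR (- n%:R) <= (2 ^+ n)^-1 :> R.
Proof.
rewrite expRN lef_pV2 ?posrE ?expR_gt0 ?exprn_gt0//.
rewrite -[n%:R]mulr1 expRM_natl lerXn2r// ?nnegrE ?expR_ge0//.
by apply: le_trans (expR_ge1Dx 1); rewrite -natr1.
Qed.

(** The potential is at least [expR (2 * Y) - 2], and [expR (2 * Y) >= 4] makes this at least half
    of [expR (2 * Y)]. *)
Lemma cosh_excess_tail lam u (Y : R) : 1 <= Y -> 2 * Y <= `|lam * u| ->
  1 <= 2 * expR (- (2 * Y)) * cosh_excess lam u.
Proof.
move=> Y1 Yu.
have h : expR `|lam * u| <= expR (lam * u) + expR (- (lam * u)).
  case: (leP 0 (lam * u)) => lu; first by rewrite ger0_norm// lerDl expR_ge0.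
  by rewrite (ler0_norm (ltW lu)) lerDr expR_ge0.
have h4 : 4 <= expR (2 * Y).
  rewrite expRM_natl; have := expR_ge1Dx Y => hY.
  by rewrite (le_trans (_ : 4 <= 2 ^+ 2)) ?lerXn2r ?nnegrE// ?expR_ge0 //; [rewrite expr2|]; lra.
have e0 : 0 < expR (- (2 * Y)) by exact: expR_gt0.
have e1 : expR (- (2 * Y)) * expR (2 * Y) = 1 by rewrite mulrC expRxMexpNx_1.
have h5 : expR (2 * Y) <= expR `|lam * u| by rewrite ler_expR.
have h6 : expR (2 * Y) / 2 <= cosh_excess lam u by rewrite /cosh_excess; lra.
have := ler_wpM2l (ltW e0) h6; lra.
Qed.

End Dyadic.

(** * From the finite net to all combinations in the [l_1] ball *)

Section LowerBound.
Context {R : realType}.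
Variables (a b : R) (nu : R -> R).
Hypothesis hnu : probability_density a b nu.
Variables (N : nat) (psi : 'I_N.+1 -> {poly R}) (K : R).
Hypotheses (K1 : 1 <= K) (psi_orth : orthonormal a b nu psi).
Hypothesis psiK : forall i y, y \in `[a, b] -> `|(psi i).[y]| <= K.
Variable L : nat.

Local Notation atom := ('I_N.+1 * bool)%type.
Local Notation pop := (pop a b nu).

(** The scale [2 ^+ L] puts every combination whose coefficients have [l_1] norm at most [2 ^+ L] in
    the convex hull of the atoms. *)
Definition dictionary (t : atom) (y : R) : R := 2 ^+ L * ((-1) ^+ t.2 * (psi t.1).[y]).

Definition net_fun k (w : {ffun 'I_k -> atom}) (y : R) : R :=
  sample_mean (dictionary ^~ y) w.

Definition combination (z : 'I_N.+1 -> R) (y : R) : R := \sum_i z i * (psi i).[y].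

Definition net_bound k (phi : R -> R) (beta : R) m (x : 'I_m -> R) :=
  forall w : {ffun 'I_k -> atom},
    pop (phi \o net_fun w) / 2 - beta <= emp x (phi \o net_fun w).

Let K0 : 0 < K. Proof. by apply: lt_le_trans K1. Qed.

Lemma measurable_net_fun k (w : {ffun 'I_k -> atom}) :
  measurable_fun setT (net_fun w).
Proof.
apply: measurable_funM => //; apply: measurable_sum => i.
apply: measurable_funM => //; apply: measurable_funM => //.
by apply: continuous_measurable_fun => y; exact: continuous_horner.
Qed.

Lemma measurable_combination z : measurable_fun setT (combination z).
Proof.
apply: measurable_sum => i; apply: measurable_funM => //.
by apply: continuous_measurable_fun => y; exact: continuous_horner.
Qed.

Lemma bm_combination z : bounded_measurable a b (combination z).
Proof. by apply: bm_sum => i _; apply: bmZ; exact: bm_horner. Qed.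

Lemma pop_combination_sqr z : pop (fun y => combination z y ^+ 2) = \sum_i z i ^+ 2.
Proof.
transitivity (pop (fun y => \sum_i \sum_j (z i * z j) * ((psi i).[y] * (psi j).[y]))).
  apply: eq_pop => y _; rewrite expr2 /combination mulr_suml; apply: eq_bigr => i _.
  by rewrite mulr_sumr; apply: eq_bigr => j _; ring.
have bij i j : bounded_measurable a b (fun y => (psi i).[y] * (psi j).[y]).
  by apply: bmM; exact: bm_horner.
have orth i j : pop (fun y => (psi i).[y] * (psi j).[y]) = (i == j)%:R.
  exact: psi_orth.
rewrite pop_sum//; last by move=> i _; apply: bm_sum => j _; exact: bmZ.
apply: eq_bigr => i _; rewrite pop_sum//; last by move=> j _; exact: bmZ.
rewrite (bigD1 i)//= big1 ?addr0.
  by rewrite popZ// orth eqxx mulr1 expr2.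
by move=> j ji; rewrite popZ// orth eq_sym (negbTE ji) mulr0.
Qed.

Lemma combination_norm_le z y : \sum_i `|z i| <= 2 ^+ L -> y \in `[a, b] ->
  `|combination z y| <= K * 2 ^+ L.
Proof.
move=> zL yI; apply: le_trans (ler_norm_sum _ _ _) _.
apply: (@le_trans _ _ (\sum_i K * `|z i|)).
  by apply: ler_sum => i _; rewrite normrM mulrC ler_wpM2r// psiK.
by rewrite -mulr_sumr ler_pM2l.
Qed.

Section Sample.
Variables (m : nat) (x : 'I_m -> R).
Hypotheses (xI : forall j, x j \in `[a, b])
  (x2 : forall i, emp x (fun y => (psi i).[y] ^+ 2) <= 3).
Variable z : 'I_N.+1 -> R.
Hypothesis zL : \sum_i `|z i| <= 2 ^+ L.

Local Notation F := (combination z).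

(** Maurey's choice with [B = K * 2 ^+ L]. The mean square of an atom is [4 ^+ L] under [nu] by
    orthonormality and at most [3 * 4 ^+ L] on the sample, hence [Q = 4 * 4 ^+ L]; dividing by
    [B ^+ 2] leaves the gain [1 / K ^+ 2]. *)
Lemma net_approximation k (lam : R) : (0 < k)%N -> 0 <= lam ->
  4 * lam * (K * 2 ^+ L) <= k%:R ->
  exists w : {ffun 'I_k -> atom},
    pop (fun y => cosh_excess lam (F y - net_fun w y)) +
    emp x (fun y => cosh_excess lam (F y - net_fun w y)) <=
    8 * (expR (2 * lam ^+ 2 * (K * 2 ^+ L) ^+ 2 / k%:R) - 1) / K ^+ 2.
Proof.
move=> k0 lam0 lamk.
have r0 : 0 < 2 ^+ L :> R by rewrite exprn_gt0.
have := @maurey R atom (signed_weight (2 ^+ L) z) (signed_weight_ge0 r0 zL)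
  (sum_signed_weight z r0) a b nu hnu k m x dictionary (K * 2 ^+ L) (4 * (2 ^+ L) ^+ 2) lam k0.
case.
- exact: mulr_gt0.
- by move=> t; do 2 apply: bmZ; exact: bm_horner.
- exact: xI.
- move=> t y yI; rewrite /dictionary normrM normrMsign.
  by rewrite (ger0_norm (ltW r0)) [leLHS]mulrC ler_pM2r// psiK.
- move=> t.
  have dE y : dictionary t y ^+ 2 = (2 ^+ L) ^+ 2 * (psi t.1).[y] ^+ 2.
    by rewrite /dictionary !exprMn sqrr_sign mul1r.
  have -> : (fun y => dictionary t y ^+ 2) = fun y => (2 ^+ L) ^+ 2 * (psi t.1).[y] ^+ 2.
    by apply/funext.
  rewrite popZ//; last by apply: bmX; exact: bm_horner.
  rewrite empZ -mulrDr mulrC ler_pM2r ?exprn_gt0//.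
  have -> : pop (fun y => (psi t.1).[y] ^+ 2) = 1.
    by have := psi_orth t.1 t.1; rewrite eqxx.
  by have := x2 t.1; lra.
- by rewrite ger0_norm.
move=> w; have Favg y : \sum_t signed_weight (2 ^+ L) z t * dictionary t y = F y.
  exact: (signed_weight_mean z r0 (fun i => (psi i).[y])).
have -> : (fun y => cosh_excess lam (\sum_t signed_weight (2 ^+ L) z t * dictionary t y -
     sample_mean (dictionary^~ y) w)) = fun y => cosh_excess lam (F y - net_fun w y).
  by apply/funext => y; rewrite Favg.
move=> H; exists w; apply: (le_trans H).
rewrite le_eqVlt; apply/orP; left; apply/eqP; field.
by rewrite !lt0r_neq0.
Qed.

(** With [G] the net function, the chain runs from [hi] of [F] under [nu] to [mid] of [G] under
    [nu], then by [net_bound] to [mid] of [G] on the sample, then to [lo] of [F] on the sample. Each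
    change of function costs [kappa] times the mean potential, once under [nu] and once on the
    sample. *)
Lemma transfer k (lo mid hi : R -> R) (M A kappa lam beta : R) :
  measurable_fun setT mid -> (forall u, 0 <= mid u <= M) ->
  measurable_fun setT hi -> (forall u, 0 <= hi u <= M) ->
  1 <= A -> 0 <= kappa ->
  (forall u v, mid v <= A * lo u + kappa * cosh_excess lam (u - v)) ->
  (forall u v, hi u <= A * mid v + kappa * cosh_excess lam (u - v)) ->
  (0 < k)%N -> 0 <= lam -> 4 * lam * (K * 2 ^+ L) <= k%:R ->
  net_bound k mid beta x ->
  pop (hi \o F) <= 2 * A ^+ 2 * emp x (lo \o F) + 2 * A * beta + 2 * A * kappa *
    (8 * (expR (2 * lam ^+ 2 * (K * 2 ^+ L) ^+ 2 / k%:R) - 1) / K ^+ 2).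
Proof.
move=> mmid midM mhi hiM A1 kappa0 Hmid Hhi k0 lam0 lamk net.
have [w Hw] := net_approximation k0 lam0 lamk; have netw := net w.
set E := 8 * (_ - 1) / _ in Hw *.
pose e y := cosh_excess lam (F y - net_fun w y).
have mnet := measurable_net_fun w.
have bnet : bounded_measurable a b (net_fun w).
  by apply: bmZ; apply: bm_sum => i _; do 2 apply: bmZ; exact: bm_horner.
have bmid : bounded_measurable a b (mid \o net_fun w).
  apply: (bm_le_cst (M := M)) => [|y _]; last exact: midM.
  by apply: measurable_funTS; exact: measurableT_comp.
have bhi : bounded_measurable a b (hi \o F).
  apply: (bm_le_cst (M := M)) => [|y _]; last exact: hiM.
  by apply: measurable_funTS; apply: measurableT_comp => //; exact: measurable_combination.
have be : bounded_measurable a b e.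
  have bd : bounded_measurable a b (fun y => F y - net_fun w y).
    by apply: bmB => //; exact: bm_combination.
  apply: bmB; last exact: bm_cst.
  by apply: bmD; apply: bm_expR; [|apply: bmN]; exact: bmZ.
have e0 y : 0 <= e y by exact: cosh_excess_ge0.
have pe0 : 0 <= pop e by apply: pop_ge0.
have ee0 : 0 <= emp x e by apply: emp_ge0.
have h1 : pop (hi \o F) <= A * pop (mid \o net_fun w) + kappa * pop e.
  rewrite -!popZ// -popD//; try exact: bmZ.
  apply: le_pop => // [|y _]; last exact: Hhi.
  by apply: bmD; exact: bmZ.
have h2 : emp x (mid \o net_fun w) <= A * emp x (lo \o F) + kappa * emp x e.
  by rewrite -!empZ -empD; apply: le_emp => j; exact: Hmid.
have A0 : 0 <= A by lra.
have h3 : A * pop (mid \o net_fun w) <=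
    A * (2 * (A * emp x (lo \o F) + kappa * emp x e + beta)) by rewrite ler_wpM2l//; lra.
have ke0 : 0 <= kappa * pop e by exact: mulr_ge0.
(* Enlarged to the coefficient of the sample error, so that the joint bound on the two errors
   applies to their sum. *)
have h4 : kappa * pop e <= 2 * A * (kappa * pop e) by rewrite ler_peMl//; lra.
have h5 : 2 * A * kappa * (pop e + emp x e) <= 2 * A * kappa * E.
  by rewrite ler_wpM2l// mulr_ge0// mulr_ge0.
apply: (le_trans h1).
have -> : 2 * A ^+ 2 * emp x (lo \o F) = A * (2 * (A * emp x (lo \o F))) by ring.
rewrite (_ : 2 * A * kappa * (pop e + emp x e) =
  2 * A * (kappa * pop e) + A * (2 * (kappa * emp x e))) in h5; last by ring.
rewrite (_ : A * (2 * (A * emp x (lo \o F) + kappa * emp x e + beta)) =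
  A * (2 * (A * emp x (lo \o F))) + A * (2 * (kappa * emp x e)) + 2 * A * beta) in h3; last by ring.
lra.
Qed.

End Sample.

End LowerBound.

(** * The truncated part, the dyadic levels and their sum *)

Section Combine.
Context {R : realType}.
Variables (a b : R) (nu : R -> R).
Hypothesis hnu : probability_density a b nu.
Variables (N : nat) (psi : 'I_N.+1 -> {poly R}) (K : R).
Hypotheses (K1 : 1 <= K) (psi_orth : orthonormal a b nu psi).
Hypothesis psiK : forall i y, y \in `[a, b] -> `|(psi i).[y]| <= K.
Variables (L : nat) (L0 : (0 < L)%N).

Local Notation pop := (pop a b nu).
Local Notation net_bound := (net_bound a b nu psi L).
Local Notation tau l := (K * 2 ^+ l).

(** The numerical factor brings the approximation error in [base_bound] down to 1/32. *)
Definition base_size : nat := (8 * 64 * 64 * 4 ^ L)%N.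

(** Put [Y = 2 * L + 8], [t = K * 2 ^+ l], [B = K * 2 ^+ L]. For [l < L] the size [k] satisfies
    [k * t ^+ 2 = 128 * Y * B ^+ 2], and [expR (- Y)] is at most [1 / (256 * 4 ^+ L)]. *)
Definition level_size (l : nat) : nat := (128 * (2 * L + 8) * 4 ^ (L - l))%N.

(* The term [1 / L] pays for the union bound over the net of the level; the term
   [4^l / 4^L], summable over the levels, keeps the failure probability of the top
   levels below [exp (- L^3 ln (N + 1))]. *)
Definition level_slack (l : nat) : R :=
  (L%:R^-1 + 4 ^+ l / 4 ^+ L) / (256 * K ^+ 2 * 4 ^+ l).

Let K0 : 0 < K. Proof. by apply: lt_le_trans K1. Qed.

Let sqr_pow2 l : (2 ^+ l) ^+ 2 = 4 ^+ l :> R.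
Proof. by rewrite -exprM mulnC exprM; congr (_ ^+ l); rewrite expr2; lra. Qed.

Section Sample.
Variables (m : nat) (x : 'I_m -> R).
Hypotheses (xI : forall j, x j \in `[a, b])
  (x2 : forall i, emp x (fun y => (psi i).[y] ^+ 2) <= 3).
Variable z : 'I_N.+1 -> R.
Hypothesis zL : \sum_i `|z i| <= 2 ^+ L.

Local Notation F := (combination psi z).

(** An instance of [transfer] with three equal functions and [A = 2]. The slack contributes [4 / 64]
    and the approximation error [1 / 32], in total [3 / 32]. *)
Lemma base_bound : net_bound base_size (trunc_sqr K) (64^-1) x ->
  pop (trunc_sqr K \o F) <= 8 * emp x (trunc_sqr K \o F) + 3 / 32.
Proof.
move=> net; set B := K * 2 ^+ L.
have B0 : 0 < B by rewrite mulr_gt0 ?exprn_gt0.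
have B0' := lt0r_neq0 B0.
have k0 : (0 < base_size)%N by rewrite !muln_gt0 expn_gt0.
have kR : base_size%:R = 8 * 64 * 64 * 4 ^+ L :> R.
  by rewrite /base_size !natrM natrX.
set k : R := base_size%:R in kR.
have q0 : 0 < 4 ^+ L :> R by rewrite exprn_gt0.
have q1 : 1 <= 4 ^+ L :> R by rewrite exprn_ege1//; lra.
have kk0 : 0 < k by rewrite kR mulr_gt0//; lra.
have lam0 : 0 <= (4 * B)^-1 by rewrite invr_ge0 mulr_ge0// ltW.
(* At [lam = 1 / (4 * B)] the lower bound on the potential is [(u - v) ^+ 2 / (64 * B ^+ 2)], whence
   the factor [128 * B ^+ 2]. *)
have quasi u v : trunc_sqr K v <= 2 * trunc_sqr K u +
    128 * B ^+ 2 * cosh_excess (4 * B)^-1 (u - v).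
  apply: (le_trans (trunc_sqr_quasi K u v)); rewrite lerD2l.
  have := cosh_excess_ge (4 * B)^-1 (u - v) => h.
  rewrite [leLHS](_ : _ = 128 * B ^+ 2 * (((4 * B)^-1 * (u - v)) ^+ 2 / 4)); last by field.
  by rewrite ler_wpM2l// mulr_ge0 ?sqr_ge0.
have := @transfer R a b nu hnu N psi K K1 psi_orth psiK L m x xI x2 z zL base_size
  (trunc_sqr K) (trunc_sqr K) (trunc_sqr K) (K ^+ 2) 2 (128 * B ^+ 2) (4 * B)^-1 (64^-1)
  (measurable_trunc_sqr K) _ (measurable_trunc_sqr K) _ _ _ quasi _ k0 lam0 _ net.
have tK u : 0 <= trunc_sqr K u <= K ^+ 2.
  by rewrite trunc_sqr_ge0 /trunc_sqr ge_min lexx orbT.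
move/(_ tK tK); rewrite -/B -/k => H; apply: (le_trans (H _ _ _ _)) => //.
- by rewrite ler1n.
- by rewrite mulr_ge0 ?sqr_ge0.
- move=> u v; have := quasi v u; rewrite (_ : cosh_excess _ (v - u) = cosh_excess (4 * B)^-1 (u - v))//.
  by rewrite /cosh_excess -(opprB u v) mulrN opprK [expR (- _) + _]addrC.
- by rewrite (_ : 4 * (4 * B)^-1 * B = 1) ?kR; [lra|field].
rewrite (_ : 2 * (4 * B)^-1 ^+ 2 * B ^+ 2 / k = (8 * k)^-1); last first.
  by field; rewrite B0' lt0r_neq0.
have h1 : expR (8 * k)^-1 - 1 <= (4 * k)^-1.
  have := @expR_le1D2x R (8 * k)^-1; rewrite (_ : 2 * _ = (4 * k)^-1); last first.
    by field; rewrite lt0r_neq0.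
  rewrite invr_ge0 mulr_ge0 ?(ltW kk0)//= lef_pV2 ?posrE ?mulr_gt0//.
  move=> /(_ _) h; suff /h : 2 <= 8 * k by lra.
  by rewrite kR; lra.
have h2 : 2 * 2 * (128 * B ^+ 2) * (8 * (expR (8 * k)^-1 - 1) / K ^+ 2) <= 32^-1.
  apply: (@le_trans _ _ (2 * 2 * (128 * B ^+ 2) * (8 * (4 * k)^-1 / K ^+ 2))).
    apply: ler_wpM2l; first by have := sqr_ge0 B; lra.
    by apply: ler_wpM2r; rewrite ?invr_ge0 ?sqr_ge0 ?ler_wpM2l.
  rewrite kR /B exprMn sqr_pow2 le_eqVlt; apply/orP; left; apply/eqP.
  by field; rewrite lt0r_neq0// lt0r_neq0.
have -> : (2 : R) * 2 ^+ 2 = 8 by rewrite expr2; lra.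
lra.
Qed.

(** The thresholds [t / 2], [3 / 4 * t] and [t] are spaced by [t / 4]. An indicator can thus be lost
    between [F] and the net function only where these differ by at least [t / 4], and there
    [cosh_excess_tail] applies. *)
Lemma level_bound l : (l < L)%N ->
  net_bound (level_size l) (exceeds (3 / 4 * tau l)) (level_slack l) x ->
  pop (exceeds (tau l) \o F) <= 2 * emp x (exceeds (tau l / 2) \o F) +
    2 * level_slack l + 32 * (4 ^+ L * 256)^-1 / K ^+ 2.
Proof.
move=> lL net; set B := K * 2 ^+ L; set t := tau l.
have B0 : 0 < B by rewrite mulr_gt0 ?exprn_gt0.
have B0' := lt0r_neq0 B0.
have k0 : (0 < level_size l)%N by rewrite !muln_gt0 expn_gt0 addn_gt0 orbT.
have t0 : 0 < t by rewrite mulr_gt0 ?exprn_gt0.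
have q0 j : 0 < 4 ^+ j :> R by rewrite exprn_gt0.
pose Y : R := (2 * L + 8)%:R.
have kR : (level_size l)%:R = 128 * Y * (4 ^+ L / 4 ^+ l) :> R.
  rewrite /level_size !natrM natrX; congr (_ * _).
  by rewrite expfB_cond// ?pnatr_eq0// ltnW.
have kB : (level_size l)%:R * t ^+ 2 = 128 * Y * B ^+ 2 :> R.
  rewrite kR /t /B !exprMn !sqr_pow2; field; rewrite lt0r_neq0//.
set k : R := (level_size l)%:R in kR kB.
have Y8 : 8 <= Y by rewrite ler_nat leq_addl.
have kk0 : 0 < k by rewrite ltr0n.
have kk0' := lt0r_neq0 kk0.
(* This value gives [lam * (t / 4) = 2 * Y] in the tail and the exponent [Y] in Maurey's bound, so
   the product of the two factors is at most [expR (- Y)]. *)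
pose lam := k * t / (16 * B ^+ 2).
have lam0 : 0 <= lam.
  apply: divr_ge0; first by rewrite mulr_ge0 ?(ltW kk0) ?(ltW t0).
  by have := sqr_ge0 B; lra.
have tB : t <= B.
  by rewrite ler_pM2l//; apply: ler_weXn2l; [rewrite ler1n|exact: ltnW].
have lamt : lam * (t / 4) = 2 * Y.
  rewrite /lam (_ : _ * (t / 4) = k * t ^+ 2 / (64 * B ^+ 2)); last by field.
  by rewrite kB; field.
have tail u : t / 4 <= `|u| -> 1 <= 2 * expR (- (2 * Y)) * cosh_excess lam u.
  move=> tu; apply: cosh_excess_tail; first by lra.
  by rewrite normrM (ger0_norm lam0) -lamt ler_wpM2l.
have kap0 : 0 <= 2 * expR (- (2 * Y)) by rewrite mulr_ge0 ?expR_ge0.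
have step (s1 s2 u v : R) : s2 = s1 + t / 4 ->
    exceeds s2 u <= 1 * exceeds s1 v + 2 * expR (- (2 * Y)) * cosh_excess lam (u - v).
  move=> ss; have ce0 : 0 <= 2 * expR (- (2 * Y)) * cosh_excess lam (u - v).
    by rewrite mulr_ge0 ?cosh_excess_ge0.
  have ev0 := exceeds_ge0 s1 v.
  rewrite {1}/exceeds; case: ltP => [su|_]; last by rewrite addr_ge0// mul1r.
  have [sv|vs] := ltP s1 `|v|; first by rewrite {1}/exceeds sv; lra.
  have := tail (u - v); have := lerB_dist u v => d1 d2.
  have : t / 4 <= `|u - v| by lra.
  by move/d2 => h; apply: (le_trans h); rewrite lerDr mul1r.
have := @transfer R a b nu hnu N psi K K1 psi_orth psiK L m x xI x2 z zL (level_size l)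
  (exceeds (t / 2)) (exceeds (3 / 4 * t)) (exceeds t) 1 1 (2 * expR (- (2 * Y))) lam (level_slack l)
  (measurable_exceeds _) _ (measurable_exceeds _) _ _ kap0 _ _ k0 lam0 _ net.
have e01 (s u : R) : 0 <= exceeds s u <= 1 by rewrite exceeds_ge0 exceeds_le1.
move/(_ (e01 _) (e01 _)); rewrite -/B -/k => H; apply: (le_trans (H _ _ _ _)) => //.
- move=> u v; rewrite (_ : cosh_excess lam (u - v) = cosh_excess lam (v - u)); last first.
    by rewrite /cosh_excess -(opprB u v) mulrN opprK [expR (- _) + _]addrC.
  by apply: step; lra.
- by move=> u v; apply: step; lra.
- rewrite (_ : 4 * lam * B = k * (t / (4 * B))); last by rewrite /lam; field.
  rewrite ler_piMr ?(ltW kk0)// ler_pdivrMr ?mulr_gt0//; lra.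
rewrite (_ : 2 * lam ^+ 2 * B ^+ 2 / k = Y); last first.
  rewrite (_ : _ / k = k * t ^+ 2 / (128 * B ^+ 2)); last by rewrite /lam; field; rewrite B0'.
  by rewrite kB; field.
rewrite expr1n !mulr1; apply: lerD => //.
have eY : expR (- Y) <= (4 ^+ L * 256)^-1.
  apply: (le_trans (expRN_nat_le _)).
  rewrite exprD exprM (_ : 2 ^+ 2 = 4 :> R); last by rewrite expr2; lra.
  by rewrite (_ : 2 ^+ 8 = 256 :> R)// -natrX.
have K2 : 0 <= (K ^+ 2)^-1 by rewrite invr_ge0 sqr_ge0.
rewrite (_ : 2 * (2 * expR (- (2 * Y))) * (8 * (expR Y - 1) / K ^+ 2) =
  32 * (expR (- (2 * Y)) * (expR Y - 1)) / K ^+ 2); last by ring.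
rewrite ler_wpM2r// ler_wpM2l//; apply: le_trans eY.
have -> : expR (- (2 * Y)) = expR (- Y) * expR (- Y) by rewrite -expRD; congr expR; lra.
have e1 : expR (- Y) * expR Y = 1 by rewrite mulrC expRxMexpNx_1.
have e0 := expR_ge0 (- Y); have : 0 <= expR (- Y) * expR (- Y) by exact: mulr_ge0.
rewrite mulrBr -mulrA e1; lra.
Qed.

(** On the sample, the truncated part and the levels cost [8 * (1 + 16 / 3) < 51] times the mean of
    [F ^+ 2]. The additive constants [3 / 32], [1 / 32] and [17 / 96] sum to less than 1/2. *)
Lemma sqr_norm_le_emp :
  net_bound base_size (trunc_sqr K) (64^-1) x ->
  (forall l : 'I_L, net_bound (level_size l) (exceeds (3 / 4 * tau l)) (level_slack l) x) ->
  \sum_i z i ^+ 2 <= 51 * emp x (fun y => F y ^+ 2) + 2^-1.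
Proof.
move=> nb nl; rewrite -(pop_combination_sqr hnu psi_orth).
have mF := measurable_combination psi z.
have bF : bounded_measurable a b F := bm_combination a b psi z.
have bphi (phi : R -> R) (M : R) : measurable_fun setT phi -> (forall u : R, 0 <= phi u <= M) ->
    bounded_measurable a b (phi \o F).
  move=> mphi phiM; apply: (bm_le_cst (M := M)) => [|y _]; last exact: phiM.
  by apply: measurable_funTS; exact: measurableT_comp.
have bt : bounded_measurable a b (trunc_sqr K \o F).
  apply: (bphi _ (K ^+ 2)) => [|u]; first exact: measurable_trunc_sqr.
  by rewrite trunc_sqr_ge0 /trunc_sqr ge_min lexx orbT.
have be s : bounded_measurable a b (exceeds s \o F).
  apply: (bphi _ 1) => [|u]; first exact: measurable_exceeds.
  by rewrite exceeds_ge0 exceeds_le1.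
have up : pop (fun y => F y ^+ 2) <= pop (trunc_sqr K \o F) +
    \sum_(l < L) 4 * (tau l) ^+ 2 * pop (exceeds (tau l) \o F).
  have bs : bounded_measurable a b
      (fun y => \sum_(l < L) 4 * (tau l) ^+ 2 * (exceeds (tau l) \o F) y).
    by apply: bm_sum => l _; exact: bmZ.
  rewrite (eq_bigr (fun l : 'I_L => pop (fun y => 4 * (tau l) ^+ 2 * (exceeds (tau l) \o F) y))).
    rewrite -pop_sum//; last by move=> l _; exact: bmZ.
    rewrite -popD//; apply: le_pop => //; [exact: bmX|exact: bmD|].
    by move=> y yI; apply: sqr_le_dyadic => //; exact: (combination_norm_le K1 psiK).
  by move=> l _; rewrite popZ.
have low : emp x (trunc_sqr K \o F) +
    \sum_(l < L) (tau l) ^+ 2 * emp x (exceeds (tau l / 2) \o F) <=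
    19 / 3 * emp x (fun y => F y ^+ 2).
  rewrite (eq_bigr (fun l : 'I_L => emp x (fun y => (tau l) ^+ 2 * (exceeds (tau l / 2) \o F) y))).
    rewrite -emp_sum -empD -empZ; apply: le_emp => j.
    have := dyadic_le_sqr L (F (x j)) K0.
    have : trunc_sqr K (F (x j)) <= F (x j) ^+ 2 by rewrite /trunc_sqr ge_min lexx.
    rewrite /comp; lra.
  by move=> l _; rewrite empZ.
have q0 j : 0 < 4 ^+ j :> R by rewrite exprn_gt0.
(* In [17 / 32], the slack contributes [1 / 32] and the approximation error [1 / 2]. *)
have lev (l : 'I_L) : 4 * (tau l) ^+ 2 * pop (exceeds (tau l) \o F) <=
    8 * ((tau l) ^+ 2 * emp x (exceeds (tau l / 2) \o F)) +
    (L%:R^-1 / 32 + 4 ^+ l * (4 ^+ L)^-1 * (17 / 32)).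
  have := level_bound (ltn_ord l) (nl l); rewrite /level_slack exprMn sqr_pow2.
  move: (pop _) (emp _ _) (4 ^+ l) (q0 l) (4 ^+ L) (q0 L) => p e q qp Q Qp.
  have L0' : L%:R != 0 :> R by rewrite pnatr_eq0 -lt0n.
  move: (L%:R) L0' => n n0 H.
  have t0 : 0 <= 4 * (K ^+ 2 * q) by rewrite !mulr_ge0 ?sqr_ge0 ?(ltW qp) ?(ltW K0).
  apply: (le_trans (ler_wpM2l t0 H)); rewrite le_eqVlt; apply/orP; left; apply/eqP.
  by field; rewrite n0 !lt0r_neq0.
have S1 : \sum_(l < L) 4 * (tau l) ^+ 2 * pop (exceeds (tau l) \o F) <=
    8 * (\sum_(l < L) (tau l) ^+ 2 * emp x (exceeds (tau l / 2) \o F)) +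
    (32^-1 + 17 / 96).
  apply: (le_trans (ler_sum _ (fun l _ => lev l))).
  rewrite big_split/= -mulr_sumr lerD2l big_split/= sumr_const card_ord.
  rewrite -mulr_suml -mulr_suml; apply: lerD.
    by rewrite -[leLHS]mulr_natr mulrAC mulVf ?mul1r// pnatr_eq0 -lt0n.
  have hs := sum_pow4_le (R := R) L.
  have h3 : (\sum_(l < L) 4 ^+ l) * (4 ^+ L)^-1 <= 3^-1 :> R.
    by rewrite ler_pdivrMr// mulrC.
  by have := ler_wpM2r (_ : 0 <= 17 / 32) h3; lra.
have : 0 <= emp x (fun y => F y ^+ 2) by apply: emp_ge0 => j; exact: sqr_ge0.
have := base_bound nb; lra.
Qed.

End Sample.
End Combine.

(** * Probability of the good event *)

Section UnionBound.
Context {R : realType} {d : measure_display} {T : measurableType d}.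
Variable P : probability T R.

Local Notation wp := (with_probability_at_least P).

Lemma wp_weaken (r r' : R) (S S' : set T) :
  r' <= r -> S `<=` S' -> wp r S -> wp r' S'.
Proof.
move=> rr SS [E [mE ES rE]]; exists E; split => //; first exact: subset_trans SS.
by apply: le_trans rE; rewrite lee_fin.
Qed.

Lemma wp_compl (A S : set T) (e : R) :
  measurable A -> (P A <= e%:E)%E -> ~` A `<=` S -> wp (1 - e) S.
Proof.
move=> mA Ae AS; exists (~` A); split => //; first exact: measurableC.
by rewrite probability_setC// EFinB leeB.
Qed.

(** The union is taken over complements of the inner measurable events, so failure probabilities add
    even when [S1] and [S2] are not measurable. *)
Lemma wp_setI (S1 S2 : set T) (e1 e2 : R) :
  wp (1 - e1) S1 -> wp (1 - e2) S2 -> wp (1 - (e1 + e2)) (S1 `&` S2).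
Proof.
move=> [E1 [mE1 ES1 P1]] [E2 [mE2 ES2 P2]].
have compl E e : measurable E -> ((1 - e)%:E <= P E)%E -> (P (~` E) <= e%:E)%E.
  move=> mE; rewrite probability_setC// -[P E]fineK ?fin_num_measure//.
  by rewrite -EFinB !lee_fin; lra.
apply: (@wp_compl (~` E1 `|` ~` E2)).
- by apply: measurableU; exact: measurableC.
- apply: (le_trans (measureU2 _ _ _)); [exact: measurableC|exact: measurableC|].
  by rewrite EFinD; apply: leeD; exact: compl.
- by rewrite setCU !setCK => w [w1 w2]; split; [exact: ES1|exact: ES2].
Qed.

Lemma wp_forall (J : finType) (S : J -> set T) (e : J -> R) :
  (forall j, wp (1 - e j) (S j)) -> wp (1 - \sum_j e j) [set w | forall j, S j w].
Proof.
move=> wS.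
suff H (r : seq J) : wp (1 - \sum_(j <- r) e j) [set w | forall j, j \in r -> S j w].
  apply: (wp_weaken (lexx _) _ (H (index_enum J))) => w wr j.
  exact/wr/mem_index_enum.
elim: r => [|j r IHr].
  rewrite big_nil; apply: (@wp_compl set0) => //; rewrite ?measure0//.
rewrite big_cons; apply: (wp_weaken (lexx _) _ (wp_setI (wS j) IHr)) => w [wj wr] i.
by rewrite inE => /orP[/eqP->//|]; exact: wr.
Qed.

End UnionBound.

(** * The lower bound holds uniformly with high probability *)

Section UniformLowerBound.
Context {R : realType}.
Variables (a b : R) (nu : R -> R).
Hypothesis hnu : probability_density a b nu.
Variables (N : nat) (psi : 'I_N.+1 -> {poly R}) (K : R).
Hypotheses (N0 : (0 < N)%N) (K1 : 1 <= K) (psi_orth : orthonormal a b nu psi).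
Hypothesis psiK : forall i y, y \in `[a, b] -> `|(psi i).[y]| <= K.
Variables (L : nat) (L2 : (2 <= L)%N).
Context {d : measure_display} {T : measurableType d}.
Variables (P : probability T R) (m : nat) (X : 'I_m -> {RV P >-> R}).
Hypotheses (m0 : (0 < m)%N) (indep : mutually_independent X)
  (dens : forall j, has_density a b nu (X j)).

Local Notation wp := (with_probability_at_least P).
Local Notation Lam := (ln N.+1%:R : R).
Local Notation sample w := (fun j => X j w).

Hypothesis mL :
  8 * 64 * 64 * 256 * K ^+ 2 * 4 ^+ L * L%:R ^+ 3 * Lam <= m%:R.

Let K0 : 0 < K. Proof. by apply: lt_le_trans K1. Qed.

Lemma wp_in_interval : wp 1 [set w | forall j, X j w \in `[a, b]].
Proof.
have H j : wp (1 - 0) (X j @^-1` `[a, b]).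
  apply: (@wp_compl _ _ _ _ (X j @^-1` ~` `[a, b])).
  - rewrite -[Y in measurable Y]setTI; apply: measurable_funP => //.
    by apply: measurableC; exact: measurable_itv.
  - by rewrite (has_density_as_in hnu).
  - by rewrite preimage_setC setCK.
by have := wp_forall H; rewrite big1// subr0.
Qed.

(** The bound 3 is [2 * 1 + 1]: twice the mean 1 plus slack 1 in [chernoff_upper]. *)
Lemma wp_second_moment :
  wp (1 - \sum_(i < N.+1) expR (- (m%:R / (2 * K ^+ 2))))
    [set w | forall i, emp (sample w) (fun y => (psi i).[y] ^+ 2) <= 3].
Proof.
apply: wp_forall => i.
have mpsi : measurable_fun setT (fun y => (psi i).[y] ^+ 2).
  apply: measurable_funX; apply: continuous_measurable_fun => y.
  exact: continuous_horner.
have bpsi y : y \in `[a, b] -> 0 <= (psi i).[y] ^+ 2 <= K ^+ 2.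
  move=> yI; rewrite sqr_ge0/= -real_normK ?num_real//.
  by rewrite lerXn2r ?nnegrE ?(ltW K0)//; exact: psiK.
have pop1 : pop a b nu (fun y => (psi i).[y] ^+ 2) = 1.
  by have := psi_orth i i; rewrite eqxx.
have := @chernoff_upper R a b nu hnu d T P m X indep dens m0 _ (K ^+ 2) 1 mpsi
  (exprn_gt0 2 K0) bpsi; rewrite pop1 !mulr1 => H.
apply: (wp_compl _ H) => [|w /=].
  rewrite -[Y in measurable Y]setTI; apply: measurable_fun_le => //.
  by apply: measurable_funM => //; exact: (measurable_sum_sample X mpsi).
by move/negP; rewrite -ltNge => /ltW; lra.
Qed.

Lemma wp_net_bound k (phi : R -> R) (M beta : R) :
  measurable_fun setT phi -> 0 < M -> (forall u, 0 <= phi u <= M) ->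
  wp (1 - \sum_(w : {ffun 'I_k -> 'I_N.+1 * bool}) expR (- (m%:R * beta / M)))
    [set w | net_bound a b nu psi L k phi beta (sample w)].
Proof.
move=> mphi M0 phiM; apply: wp_forall => v.
have mv : measurable_fun setT (phi \o net_fun psi L v).
  by apply: measurableT_comp => //; exact: measurable_net_fun.
have H := @chernoff_lower R a b nu hnu d T P m X indep dens m0 _ M beta mv M0
  (fun y _ => phiM _).
apply: (wp_compl _ H) => [|w /=].
  rewrite -[Y in measurable Y]setTI; apply: measurable_fun_le => //.
  apply: measurable_funM => //.
  exact: (measurable_sum_sample X mv).
by move/negP; rewrite -ltNge => /ltW.
Qed.

Let Lam_ge : 2^-1 <= Lam.
Proof. by apply: le_trans half_le_ln2 _; rewrite ler_ln ?posrE// ler_nat. Qed.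

(** The sum has [(2 (N + 1)) ^ k] terms, at most [expR (2 * k * Lam)] since [2 <= N + 1]. The
    exponent [t] pays for them and keeps [2 * L ^+ 3 * Lam] in reserve. *)
Let card_net_expR k (t : R) :
  2 * k%:R * Lam + 2 * L%:R ^+ 3 * Lam <= t ->
  \sum_(w : {ffun 'I_k -> 'I_N.+1 * bool}) expR (- t) <= expR (- (2 * L%:R ^+ 3 * Lam)).
Proof.
move=> kt; rewrite sumr_const card_ffun card_prod !card_ord card_bool.
have D : (N.+1 * 2)%:R <= expR (2 * Lam) :> R.
  rewrite expRM_natl lnK ?posrE ?ltr0n// -natrX ler_nat expnS expn1.
  by rewrite leq_mul2l /= ltnS.
have Dk : ((N.+1 * 2) ^ k)%:R <= expR (2 * k%:R * Lam) :> R.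
  rewrite (_ : 2 * k%:R * Lam = k%:R * (2 * Lam)); last by ring.
  by rewrite expRM_natl natrX lerXn2r// nnegrE ?expR_ge0.
rewrite -[leLHS]mulr_natl; apply: (le_trans (ler_wpM2r (expR_ge0 _) Dk)).
by rewrite -expRD ler_expR; lra.
Qed.

Let m_ge_base : 4 * (8 * 64 * 64) * 4 ^+ L * L%:R ^+ 3 * Lam <= m%:R * 64^-1 / K ^+ 2.
Proof.
have K2 : 0 < K ^+ 2 by rewrite exprn_gt0.
rewrite ler_pdivlMr// ler_pdivlMr//; apply: le_trans mL.
rewrite le_eqVlt; apply/orP; left; apply/eqP; ring.
Qed.

(** Besides the almost sure event there are [L + 2] events, each failing with probability at most
    [eta]. Half of the exponent in [eta] absorbs their number, because [L + 2 <= 1 + L ^+ 3 * Lam]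
    for [L >= 2] and [Lam >= 1/2]. *)
Lemma uniform_lower_bound :
  wp (1 - expR (- (L%:R ^+ 3 * Lam)))
    [set w | (forall j, X j w \in `[a, b]) /\
      forall z : 'I_N.+1 -> R, \sum_i `|z i| <= 2 ^+ L ->
        \sum_i z i ^+ 2 <=
        51 * emp (sample w) (fun y => combination psi z y ^+ 2) + 2^-1].
Proof.
have LR : 2 <= L%:R :> R by rewrite ler_nat.
have L0 : (0 < L)%N by apply: leq_trans L2.
have Lam0 : 0 <= Lam by have := Lam_ge; lra.
have L3 : 8 <= L%:R ^+ 3 :> R.
  by rewrite -natrX ler_nat (leq_exp2r 2 _ (isT : 0 < 3)%N).
have Q1 : 1 <= 4 ^+ L :> R by rewrite exprn_ege1// ler1n.
set eta := expR (- (2 * L%:R ^+ 3 * Lam)).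
have base_eta : \sum_(w : {ffun 'I_(base_size L) -> 'I_N.+1 * bool})
    expR (- (m%:R * 64^-1 / K ^+ 2)) <= eta.
  apply: card_net_expR; apply: le_trans m_ge_base.
  rewrite /base_size !natrM natrX -!mulrDl ler_wpM2r//.
  move: (4 ^+ L) Q1 (L%:R ^+ 3) L3 => Q Q1 l3 L3; nra.
have moment_eta : \sum_(i < N.+1) expR (- (m%:R / (2 * K ^+ 2))) <= eta.
  rewrite sumr_const card_ord -[leLHS]mulr_natl -[N.+1%:R in leLHS]lnK ?posrE ?ltr0n//.
  rewrite /eta -expRD ler_expR.
  have : 32 * (m%:R * 64^-1 / K ^+ 2) = m%:R / (2 * K ^+ 2).
    by field; rewrite lt0r_neq0.
  have := m_ge_base.
  have : Lam + 2 * L%:R ^+ 3 * Lam <= 4 * (8 * 64 * 64) * 4 ^+ L * L%:R ^+ 3 * Lam.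
    rewrite -[X in X + _]mul1r -mulrDl ler_wpM2r//.
    move: (4 ^+ L) Q1 (L%:R ^+ 3) L3 => Q Q1 l3 L3; nra.
  have : 0 <= L%:R ^+ 3 * Lam by rewrite mulr_ge0 ?exprn_ge0.
  rewrite -[2 * _ * Lam]mulrA; lra.
have level_eta (l : 'I_L) : \sum_(w : {ffun 'I_(level_size L l) -> 'I_N.+1 * bool})
    expR (- (m%:R * level_slack K L l / 1)) <= eta.
  apply: card_net_expR; rewrite divr1.
  have q0 j : 0 < 4 ^+ j :> R by rewrite exprn_gt0.
  have -> : (level_size L l)%:R = 128 * (2 * L%:R + 8) * (4 ^+ L / 4 ^+ l) :> R.
    rewrite /level_size !natrM natrX natrD natrM; congr (_ * _).
    by rewrite expfB_cond// pnatr_eq0 (ltnW (ltn_ord l)).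
  apply: (@le_trans _ _ ((8 * 64 * 64 * 256 * K ^+ 2 * 4 ^+ L * L%:R ^+ 3 * Lam) *
      level_slack K L l)); last first.
    apply: ler_wpM2r; last exact: mL.
    apply: divr_ge0; first by apply: addr_ge0; rewrite ?invr_ge0// divr_ge0// ltW.
    by apply: mulr_ge0; [have := sqr_ge0 K; lra|exact: ltW].
  (* The two terms of [level_slack] separate: the one with [L ^+ 2] pays for the net, the one with
     [L ^+ 3] for the failure probability. *)
  have -> : 8 * 64 * 64 * 256 * K ^+ 2 * 4 ^+ L * L%:R ^+ 3 * Lam * level_slack K L l =
      8 * 64 * 64 * (L%:R ^+ 2 * (4 ^+ L / 4 ^+ l) + L%:R ^+ 3) * Lam.
    by rewrite /level_slack; field; rewrite !lt0r_neq0//; lra.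
  rewrite -!mulrDl ler_wpM2r//.
  have : 0 <= 4 ^+ L / 4 ^+ l :> R by rewrite divr_ge0 ?(ltW (q0 _)).
  move: (4 ^+ L / 4 ^+ l) => q qq0.
  have h1 : (2 * L%:R + 8) * q <= 4 * L%:R ^+ 2 * q :> R by rewrite ler_wpM2r//; nra.
  have h2 : 0 <= L%:R ^+ 2 * q by rewrite mulr_ge0 ?sqr_ge0.
  lra.
have total : 0 + (eta + (eta + \sum_(l < L) eta)) <= expR (- (L%:R ^+ 3 * Lam)).
  rewrite sumr_const card_ord -[eta *+ L]mulr_natl add0r.
  have -> : eta + (eta + L%:R * eta) = (L%:R + 2) * eta by ring.
  rewrite /eta (_ : - (2 * L%:R ^+ 3 * Lam) = - (L%:R ^+ 3 * Lam) + - (L%:R ^+ 3 * Lam)); last by ring.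
  rewrite expRD mulrA ler_piMl ?expR_ge0// expRN ler_pdivrMr ?expR_gt0// mul1r.
  apply: le_trans (expR_ge1Dx _).
  have := Lam_ge; move: (Lam) (L%:R : R) LR {Lam0 L3} => la l lR laR.
  have : l ^+ 3 * 2^-1 <= l ^+ 3 * la by rewrite ler_wpM2l// exprn_ge0//; lra.
  nra.
have wI : wp (1 - 0) [set w | forall j, X j w \in `[a, b]] by rewrite subr0; exact: wp_in_interval.
have wlev := @wp_forall R d T P 'I_L
  (fun l => [set w | net_bound a b nu psi L (level_size L l)
    (exceeds (3 / 4 * (K * 2 ^+ l))) (level_slack K L l) (sample w)]) _
  (fun l => wp_net_bound (level_size L l) (level_slack K L l)
    (measurable_exceeds _) ltr01 (fun u => introT andP (conj (exceeds_ge0 _ u) (exceeds_le1 _ u)))).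
have tK (u : R) : 0 <= trunc_sqr K u <= K ^+ 2.
  by rewrite trunc_sqr_ge0 /trunc_sqr ge_min lexx orbT.
have wbase := wp_net_bound (base_size L) 64^-1 (measurable_trunc_sqr K) (exprn_gt0 2 K0) tK.
have := wp_setI wI (wp_setI wp_second_moment (wp_setI wbase wlev)).
apply: wp_weaken.
  rewrite lerD2l lerN2; apply: le_trans total.
  apply: lerD => //; apply: lerD; first exact: moment_eta.
  apply: lerD; first exact: base_eta.
  by apply: ler_sum => l _; exact: level_eta.
move=> w /= [wIw [w2 [wb wl]]]; split => // z zL.
exact: (sqr_norm_le_emp hnu K1 psi_orth psiK L0 wIw w2 zL wb wl).
Qed.

End UniformLowerBound.

(** * Sparse recovery and best approximation *)

Section VectorNorms.
Context {R : realType} {n : nat}.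
Implicit Types z x c : 'cV[R]_n.

Lemma lpnorm1E z : lpnorm 1 z = \sum_i `|z i 0|.
Proof.
rewrite /lpnorm invr1; under eq_bigr do rewrite powRr1//.
by rewrite powRr1// sumr_ge0.
Qed.

Lemma lpnorm2E z : lpnorm 2 z = Num.sqrt (\sum_i z i 0 ^+ 2).
Proof.
rewrite /lpnorm powR12_sqrt; last by rewrite sumr_ge0// => i _; exact: powR_ge0.
by congr Num.sqrt; apply: eq_bigr => i _; rewrite powR_mulrn// real_normK ?num_real.
Qed.

Lemma best_sterm_error_le s z x : (l0norm x <= s)%N ->
  best_sterm_error s 1 z <= lpnorm 1 (z - x).
Proof.
move=> xs; apply: ge_inf; last by exists x.
by exists 0 => _ [v _ <-]; exact: powR_ge0.
Qed.

(* AM-GM: [2 |h_i| <= sqrt s * h_i^2 / ||h||_2 + ||h||_2 / sqrt s]. *)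
Lemma sum_support_le s (S : {set 'I_n}) (h : 'cV[R]_n) : (0 < s)%N -> (#|S| <= s)%N ->
  \sum_(i in S) `|h i 0| <= Num.sqrt s%:R * Num.sqrt (\sum_i h i 0 ^+ 2).
Proof.
move=> s0 Ss; have sR : 0 < s%:R :> R by rewrite ltr0n.
set H2 := \sum_i _; have H20 : 0 <= H2 by apply: sumr_ge0 => i _; exact: sqr_ge0.
set r := Num.sqrt s%:R; set H := Num.sqrt H2.
have r0 : 0 < r by rewrite sqrtr_gt0.
have r2 : r ^+ 2 = s%:R by rewrite sqr_sqrtr ?ler0n.
have HH : H ^+ 2 = H2 by rewrite sqr_sqrtr.
(* The weighted inequality used below divides by [H]. *)
have [H0|H0] := eqVneq H 0.
  have /psumr_eq0P h0 : H2 = 0 by rewrite -HH H0 expr0n.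
  rewrite H0 mulr0 big1// => i _.
  have /eqP := h0 (fun i _ => sqr_ge0 _) i isT.
  by rewrite sqrf_eq0 => /eqP ->; rewrite normr0.
have Hp : 0 < H by rewrite lt_neqAle eq_sym H0 sqrtr_ge0.
apply: (@le_trans _ _ (\sum_(i in S) (r / (2 * H) * h i 0 ^+ 2 + H / (2 * r)))).
  apply: ler_sum => i _; rewrite -[h i 0 ^+ 2]real_normK ?num_real//.
  rewrite -subr_ge0.
  have -> : r / (2 * H) * `|h i 0| ^+ 2 + H / (2 * r) - `|h i 0| =
    (r * `|h i 0| - H) ^+ 2 / (2 * H * r) by field; rewrite lt0r_neq0.
  by rewrite divr_ge0 ?sqr_ge0// ltW// !mulr_gt0.
rewrite big_split/= -mulr_sumr sumr_const -[X in _ + X]mulr_natl.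
have h1 : \sum_(i in S) h i 0 ^+ 2 <= H ^+ 2.
  rewrite HH /H2 [leRHS](bigID (mem S))/= lerDl sumr_ge0// => i _; exact: sqr_ge0.
have h2 : #|S|%:R <= r ^+ 2 by rewrite r2 ler_nat.
apply: (@le_trans _ _ (r / (2 * H) * H ^+ 2 + r ^+ 2 * (H / (2 * r)))).
  apply: lerD; first by rewrite ler_wpM2l// ltW// divr_gt0// mulr_gt0.
  by rewrite ler_wpM2r// ltW// divr_gt0// mulr_gt0.
rewrite le_eqVlt; apply/orP; left; apply/eqP; field.
by rewrite H0 lt0r_neq0.
Qed.

(** Let [h = c - c0]. Off the support of [x], [|h_i| <= |c_i| + |c0_i|]; on it, doubling [|h_i|]
    absorbs [|c0_i| - |c_i|]. The sum of [|c_i| - |c0_i|] is nonpositive by hypothesis. An arbitrary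
    [x] postpones the infimum over sparse vectors. *)
Lemma l1_cone s c c0 x : (0 < s)%N -> (l0norm x <= s)%N ->
  lpnorm 1 c <= lpnorm 1 c0 ->
  lpnorm 1 (c - c0) <= 2 * (Num.sqrt s%:R * lpnorm 2 (c - c0)) + 2 * lpnorm 1 (c0 - x).
Proof.
move=> s0 xs; rewrite !lpnorm1E lpnorm2E => cc.
pose S := [set i | x i 0 != 0]%SET.
have := sum_support_le (c - c0) s0 xs; rewrite -/S => hS.
have : \sum_i `|(c - c0) i 0| <= \sum_i ((if i \in S then 2 * `|(c - c0) i 0| else 0) +
    2 * `|(c0 - x) i 0| + (`|c i 0| - `|c0 i 0|)).
  apply: ler_sum => i _; rewrite !mxE.
  have t1 := lerB_dist (c0 i 0) (c i 0); have t2 := ler_normB (c i 0) (c0 i 0).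
  rewrite distrC in t1; case: ifPn => iS.
    by have := normr_ge0 (c0 i 0 - x i 0); lra.
  by move: iS; rewrite inE negbK => /eqP ->; rewrite subr0; lra.
rewrite !big_split/= -mulr_sumr -big_mkcond/= -mulr_sumr sumrN; lra.
Qed.

(* Entries above the threshold [s^(-1/q) ||z||_q] are at most [s] many. *)
Lemma stechkin (q : R) s z : 0 < q < 1 -> (0 < s)%N ->
  best_sterm_error s 1 z <= s%:R `^ (1 - q^-1) * (\sum_i `|z i 0| `^ q) `^ q^-1.
Proof.
move=> /andP[q0 q1] s0; set W := \sum_i _.
have sR : 0 < s%:R :> R by rewrite ltr0n.
have z0 i : 0 <= `|z i 0| `^ q by exact: powR_ge0.
have W0 : 0 <= W by exact: sumr_ge0.
have zW i : `|z i 0| `^ q <= W by rewrite /W (bigD1 i)//= lerDl sumr_ge0.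
pose t := (W / s%:R) `^ q^-1.
have t0 : 0 <= t by exact: powR_ge0.
have Ws0 : 0 <= W / s%:R by rewrite divr_ge0.
have tq : t `^ q = W / s%:R by rewrite /t -powRrM mulVf ?lt0r_neq0// powRr1.
pose x : 'cV[R]_n := \col_i (if t < `|z i 0| then z i 0 else 0).
have xs : (l0norm x <= s)%N.
  have [Wz|Wn] := eqVneq W 0.
    rewrite /l0norm (_ : [set i | _]%SET = finset.set0) ?cards0//.
    apply/setP => i; rewrite !inE mxE; case: ifP => [|_]; last by rewrite eqxx.
    have : `|z i 0| `^ q <= 0 by rewrite -Wz.
    move=> zi; have /eqP : `|z i 0| `^ q = 0 by apply/le_anti; rewrite zi z0.
    by rewrite powR_eq0 normr_eq0 => /andP[/eqP-> _]; rewrite normr0 ltNge t0.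
  have Wp : 0 < W by rewrite lt_neqAle eq_sym Wn.
  rewrite -(ler_nat R) -(ler_pM2r (divr_gt0 Wp sR)) [leRHS]mulrCA mulfV ?lt0r_neq0// mulr1.
  apply: (@le_trans _ _ (\sum_(i in [set i | x i 0 != 0]%SET) `|z i 0| `^ q)); last first.
    by rewrite /W [leRHS](bigID (mem [set i | x i 0 != 0]%SET))/= lerDl sumr_ge0.
  rewrite /l0norm mulr_natl -sumr_const; apply: ler_sum => i.
  rewrite inE mxE; case: ifP => [tz _|_]; last by rewrite eqxx.
  by rewrite -tq; apply: ge0_ler_powR; rewrite ?nnegrE// ltW.
apply: (le_trans (best_sterm_error_le z xs)); rewrite lpnorm1E.
apply: (@le_trans _ _ (\sum_i t `^ (1 - q) * `|z i 0| `^ q)).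
  apply: ler_sum => i _; rewrite !mxE; case: ltP => [_|zt].
    by rewrite subrr normr0 mulr_ge0 ?powR_ge0.
  rewrite subr0; have [->|zn] := eqVneq (z i 0) 0.
    by rewrite normr0 mulr_ge0 ?powR_ge0.
  rewrite -[leLHS]powRr1// (_ : 1 = (1 - q) + q); last by ring.
  rewrite powRD; last by rewrite normr_eq0 zn implybT.
  rewrite (_ : 1 - q + q - q = 1 - q); last by ring.
  rewrite ler_wpM2r//; apply: ge0_ler_powR; rewrite ?nnegrE//; lra.
rewrite -mulr_sumr -/W.
have [->|Wn] := eqVneq W 0; first by rewrite mulr0 mulr_ge0 ?powR_ge0.
have Wp : 0 < W by rewrite lt_neqAle eq_sym Wn.
have e1 : t `^ (1 - q) = W `^ (q^-1 - 1) * s%:R `^ (1 - q^-1).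
  rewrite /t -powRrM (_ : q^-1 * (1 - q) = q^-1 - 1); last by field; rewrite lt0r_neq0.
  by rewrite powRM ?invr_ge0// -[s%:R^-1]powR_inv1 ?ler0n// -powRrM mulN1r opprB.
have e2 : W `^ (q^-1 - 1) * W = W `^ q^-1.
  by rewrite -[X in _ * X](powRr1 W0) -powRD ?subrK// Wn implybT.
by rewrite e1 mulrAC e2 mulrC.
Qed.

End VectorNorms.

(** * Orthogonality of the residual of the best approximation *)

Section BestApproximation.
Context {R : realType}.
Variables (a b : R) (nu : R -> R).
Hypotheses (ab : a < b) (hnu : probability_density a b nu).
Local Notation pop := (pop a b nu).

Lemma within_continuous_bm (f : R -> R) :
  {within `[a, b], continuous f} -> bounded_measurable a b f.
Proof.
move=> cf; split.
  by apply: subspace_continuous_measurable_fun => //; exact: measurable_itv.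
have [M MI fM] := EVT_max (ltW ab) cf; have [m mI fm] := EVT_min (ltW ab) cf.
exists (`|f M| + `|f m|) => x xI.
have := fM x xI; have := fm x xI; have := ler_norm (f M); have := ler_norm (- f m).
rewrite normrN => h1 h2 h3 h4; have := normr_ge0 (f M); have := normr_ge0 (f m) => h5 h6.
by rewrite ler_norml; apply/andP; split; lra.
Qed.

Lemma le_supnorm (g : R -> R) x : bounded_measurable a b g -> x \in `[a, b] ->
  `|g x| <= supnorm a b g.
Proof.
move=> [_ [M gM]] xI; apply: ub_le_sup; last by exists x.
by exists M => _ [y yI <-]; exact: gM.
Qed.

Lemma L2norm_sqr (g : R -> R) : L2norm a b nu g ^+ 2 = pop (fun x => g x ^+ 2).
Proof. by rewrite sqr_sqrtr//; apply: (pop_ge0 hnu) => x _; exact: sqr_ge0. Qed.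

(** Moving from [p] to [p + e *: r], with [e] the inner product in question, lowers the squared
    error by [e ^+ 2]; optimality forces [e = 0]. *)
Lemma best_square_approx_orth (f : R -> R) N (p r : {poly R}) :
  bounded_measurable a b f -> best_square_approx a b nu f N p ->
  (size r <= N.+1)%N -> pop (fun x => r.[x] ^+ 2) = 1 ->
  pop (fun x => (f x - p.[x]) * r.[x]) = 0.
Proof.
move=> bf [sp Ep] sr r1; set e := pop _.
have bT : bounded_measurable a b (fun x => f x - p.[x]).
  by apply: bmB => //; exact: bm_horner.
have br := bm_horner a b r.
have : L2norm a b nu (fun x => f x - p.[x]) <=
    L2norm a b nu (fun x => f x - (p + e *: r).[x]).
  rewrite Ep; apply: ge_inf; first by exists 0 => _ [v _ <-]; exact: sqrtr_ge0.
  exists (p + e *: r) => //=; apply: (leq_trans (size_polyD _ _)).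
  by rewrite geq_max sp (leq_trans (size_scale_leq _ _)).
rewrite -ler_sqr ?nnegrE ?sqrtr_ge0// !L2norm_sqr.
have -> : pop (fun x => (f x - (p + e *: r).[x]) ^+ 2) =
    pop (fun x => (f x - p.[x]) ^+ 2) - e ^+ 2.
  rewrite (eq_pop _ (h := fun x => (f x - p.[x]) ^+ 2 - (2 * e) * ((f x - p.[x]) * r.[x])
      + e ^+ 2 * r.[x] ^+ 2)); last by move=> x _; rewrite hornerD hornerZ; ring.
  have b1 := bmX 2 bT; have b2 := bmM bT br; have b3 := bmX 2 br.
  rewrite (popD hnu); [|apply: bmB => //; exact: bmZ|exact: bmZ].
  rewrite (popB hnu)//; last exact: bmZ.
  by rewrite !(popZ hnu)// r1 -/e; ring.
move=> h; apply/eqP; rewrite -sqrf_eq0 eq_le sqr_ge0 andbT; lra.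
Qed.

Variables (N : nat) (psi : 'I_N.+1 -> {poly R}).
Hypotheses (psi_orth : orthonormal a b nu psi)
  (psi_size : forall k, (size (psi k) <= N.+1)%N).

Lemma horner_expansion (c : 'cV[R]_N.+1) x :
  (expansion psi c).[x] = combination psi (fun i => c i 0) x.
Proof. by rewrite /expansion horner_sum; apply: eq_bigr => i _; rewrite hornerZ. Qed.

Let psi_sqr k : pop (fun x => (psi k).[x] ^+ 2) = 1.
Proof. by have := psi_orth k k; rewrite eqxx. Qed.

Section Fixed.
Variables (f : R -> R) (p : {poly R}) (c0 : 'cV[R]_N.+1).
Hypotheses (bf : bounded_measurable a b f) (hp : best_square_approx a b nu f N p)
  (pE : p = expansion psi c0).

(** The residual is orthogonal to [psi k], so [f] and [p] have the same inner product with it. This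
    ties the coefficients to the sequence in [Aq_norm]. *)
Lemma coefficient_best_approx k : c0 k 0 = dot a b nu f (horner (psi k)).
Proof.
have bpsi k' := bm_horner a b (psi k').
have orth := best_square_approx_orth bf hp (psi_size k) (psi_sqr k).
have b1 : bounded_measurable a b (fun x => f x * (psi k).[x]) by exact: bmM.
have b2 i : bounded_measurable a b (fun x => (psi i).[x] * (psi k).[x]) by exact: bmM.
have : pop (fun x => (f x - p.[x]) * (psi k).[x]) =
    dot a b nu f (horner (psi k)) - \sum_i c0 i 0 * dot a b nu (horner (psi i)) (horner (psi k)).
  rewrite (eq_pop _ (h := fun x => f x * (psi k).[x] -
    \sum_i c0 i 0 * ((psi i).[x] * (psi k).[x]))); last first.
    move=> x _; rewrite pE horner_expansion mulrBl /combination mulr_suml.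
    by congr (_ - _); apply: eq_bigr => i _; rewrite mulrA.
  rewrite (popB hnu)//; last by apply: bm_sum => i _; exact: bmZ.
  congr (_ - _); rewrite (pop_sum hnu); last by move=> i _; exact: bmZ.
  by apply: eq_bigr => i _; rewrite (popZ hnu).
rewrite orth (bigD1 k)//= big1 ?addr0; last first.
  by move=> i ik; rewrite psi_orth (negbTE ik) mulr0.
by rewrite psi_orth eqxx mulr1; lra.
Qed.

(** Pythagoras: [f - p] is orthogonal to the span of [psi], so the squared error is a sum of two
    squares, at most the square of the sum. *)
Lemma L2norm_error_le (c : 'cV[R]_N.+1) :
  L2norm a b nu (fun x => f x - (expansion psi c).[x]) <=
  L2norm a b nu (fun x => f x - p.[x]) + lpnorm 2 (c - c0).
Proof.
pose z i := (c - c0) i 0; pose T x := f x - p.[x].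
have bT : bounded_measurable a b T by apply: bmB => //; exact: bm_horner.
have bF : bounded_measurable a b (combination psi z) := bm_combination a b psi z.
have cross : pop (fun x => T x * combination psi z x) = 0.
  rewrite (eq_pop _ (h := fun x => \sum_i z i * (T x * (psi i).[x]))); last first.
    by move=> x _; rewrite mulr_sumr; apply: eq_bigr => i _; rewrite mulrCA.
  have bi i : bounded_measurable a b (fun x => T x * (psi i).[x]).
    by apply: bmM => //; exact: bm_horner.
  rewrite (pop_sum hnu); last by move=> i _; exact: bmZ.
  rewrite big1// => i _; rewrite (popZ hnu)//.
  by rewrite (best_square_approx_orth bf hp (psi_size i) (psi_sqr i)) mulr0.
have T0 : 0 <= L2norm a b nu T by exact: sqrtr_ge0.
have z0 : 0 <= lpnorm 2 (c - c0) by exact: powR_ge0.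
rewrite -ler_sqr ?nnegrE ?sqrtr_ge0 ?addr_ge0// L2norm_sqr.
rewrite (eq_pop _ (h := fun x => (T x ^+ 2 - 2 * (T x * combination psi z x)) +
    combination psi z x ^+ 2)); last first.
  move=> x _; have -> : f x - (expansion psi c).[x] = T x - combination psi z x.
    rewrite /T pE !horner_expansion (_ : combination psi z x =
      combination psi (fun i => c i 0) x - combination psi (fun i => c0 i 0) x); first by ring.
    by rewrite /combination -sumrB; apply: eq_bigr => i _; rewrite /z !mxE; ring.
  by ring.
have b1 := bmX 2 bT; have b2 := bmM bT bF; have b3 := bmX 2 bF.
rewrite (popD hnu)//; last by apply: bmB => //; exact: bmZ.
rewrite (popB hnu)//; last exact: bmZ.
rewrite (popZ hnu)// cross (pop_combination_sqr hnu psi_orth) -L2norm_sqr.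
have -> : \sum_i z i ^+ 2 = lpnorm 2 (c - c0) ^+ 2.
  by rewrite lpnorm2E sqr_sqrtr// sumr_ge0// => i _; exact: sqr_ge0.
rewrite -/T; nra.
Qed.

End Fixed.

End BestApproximation.

Section RealInequalities.
Context {R : realType}.

Lemma sqrB_le (u w : R) : (u - w) ^+ 2 <= 2 * u ^+ 2 + 2 * w ^+ 2.
Proof. by have := sqr_ge0 (u + w); nra. Qed.

(** Either the first implication gives [H ^+ 2 <= 408 * t ^+ 2], with [408 <= 22 ^+ 2], or
    [4 * r * H <= H1] and the term [2 * (r * H)] is absorbed. *)
Lemma cone_dichotomy (H H1 S r l E t : R) :
  0 <= H -> 0 <= S -> 0 < r -> 0 <= t -> 4 * r <= l ->
  (H1 <= l * H -> H ^+ 2 <= 102 * E) -> E <= 4 * t ^+ 2 ->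
  H1 <= 2 * (r * H) + 2 * S -> H <= S / r + 22 * t.
Proof.
move=> H0 S0 r0 t0 rl low Et cone.
have Sr0 : 0 <= S / r by rewrite divr_ge0// ltW.
have [/low hE|/ltW hl] := leP H1 (l * H).
  have : H <= 22 * t by rewrite -ler_sqr ?nnegrE ?mulr_ge0//; have := sqr_ge0 t; nra.
  lra.
have h3 : 4 * r * H <= l * H by rewrite ler_wpM2r.
have h4 : H <= S / r by rewrite ler_pdivlMr//; lra.
lra.
Qed.

End RealInequalities.

(** * Deterministic recovery from the uniform lower bound *)

Section Recovery.
Context {R : realType}.
Variables (N m s L : nat) (psi : 'I_N.+1 -> {poly R}) (x : 'I_m -> R).
Hypotheses (m0 : (0 < m)%N) (s0 : (0 < s)%N) (sL : (16 * s <= 4 ^ L)%N).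
Hypothesis lower : forall z : 'I_N.+1 -> R, \sum_i `|z i| <= 2 ^+ L ->
  \sum_i z i ^+ 2 <= 51 * emp x (fun y => combination psi z y ^+ 2) + 2^-1.

Let energy (h : 'cV[R]_N.+1) :=
  emp x (fun y => combination psi (fun i => h i 0) y ^+ 2).

(** By homogeneity, for [h / ||h||_2] the lower bound reads
    [1 <= 51 * energy h / ||h||_2 ^+ 2 + 1/2], and the additive 1/2 is absorbed. *)
Lemma lower_bound_on_cone (h : 'cV[R]_N.+1) :
  lpnorm 1 h <= 2 ^+ L * lpnorm 2 h -> lpnorm 2 h ^+ 2 <= 102 * energy h.
Proof.
move=> hL; set H := lpnorm 2 h in hL *.
have H0 : 0 <= H by exact: powR_ge0.
have H2 : H ^+ 2 = \sum_i h i 0 ^+ 2.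
  by rewrite /H lpnorm2E sqr_sqrtr// sumr_ge0// => i _; exact: sqr_ge0.
have E0 : 0 <= energy h by apply: emp_ge0 => j; exact: sqr_ge0.
have [->|Hn] := eqVneq H 0; first by rewrite expr0n/= mulr_ge0.
have Hp : 0 < H by rewrite lt_neqAle eq_sym Hn.
have Hp2 : 0 < H ^+ 2 by rewrite exprn_gt0.
have := @lower (fun i => H^-1 * h i 0).
have -> : \sum_i `|H^-1 * h i 0| = lpnorm 1 h / H.
  rewrite lpnorm1E mulrC mulr_sumr; apply: eq_bigr => i _.
  by rewrite normrM ger0_norm// invr_ge0.
rewrite ler_pdivrMr// => /(_ hL).
have -> : \sum_i (H^-1 * h i 0) ^+ 2 = 1.
  by under eq_bigr do rewrite exprMn; rewrite -mulr_sumr -H2 -exprMn mulVf ?expr1n.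
have -> : emp x (fun y => combination psi (fun i => H^-1 * h i 0) y ^+ 2) =
    H ^- 2 * energy h.
  rewrite -empZ; congr emp; apply/funext => y; rewrite -exprVn -exprMn; congr (_ ^+ 2).
  by rewrite /combination mulr_sumr; apply: eq_bigr => i _; rewrite mulrA.
move=> h1; have : H ^+ 2 * 1 <= H ^+ 2 * (51 * (H ^- 2 * energy h) + 2^-1).
  by rewrite ler_pM2l.
have -> : H ^+ 2 * (51 * (H ^- 2 * energy h) + 2^-1) = 51 * energy h + H ^+ 2 / 2.
  by field.
lra.
Qed.

(** The vector [c0] is feasible since the noise is at most [t] entrywise and [Theta >= 1], so
    [l1_cone] applies to [c - c0]. Its image under the sampling matrix is a difference of two
    residuals of norm at most [eta], so its energy is at most [4 * (Theta * t) ^+ 2]. *)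
Lemma l1_minimizer_error (c c0 v : 'cV[R]_N.+1) (y : 'cV[R]_m) (Theta : nat) (t : R) :
  (0 < Theta)%N -> 0 <= t ->
  (forall j, `|(sampling_matrix psi x *m c0 - y) j 0| <= t) ->
  l1_minimizer (sampling_matrix psi x) y (Theta%:R * Num.sqrt m%:R * t) c ->
  (l0norm v <= s)%N ->
  lpnorm 2 (c - c0) <= lpnorm 1 (c0 - v) / Num.sqrt s%:R + 22 * Theta%:R * t.
Proof.
move=> Th0 t0 noise [feas mini] vs; set eta := Theta%:R * _ * t in feas mini.
have ThR : 1 <= Theta%:R :> R by rewrite ler1n.
have mR : 0 < m%:R :> R by rewrite ltr0n.
have sR : 0 < s%:R :> R by rewrite ltr0n.
have eta0 : 0 <= eta by rewrite !mulr_ge0.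
have eta2 : eta ^+ 2 = (Theta%:R * t) ^+ 2 * m%:R.
  by rewrite /eta mulrAC exprMn sqr_sqrtr ?ler0n.
have sq0 k (u : 'cV[R]_k) : 0 <= \sum_i u i 0 ^+ 2.
  by apply: sumr_ge0 => i _; exact: sqr_ge0.
have noise2 : \sum_j (sampling_matrix psi x *m c0 - y) j 0 ^+ 2 <= eta ^+ 2.
  rewrite eta2; apply: (@le_trans _ _ (\sum_(j < m) t ^+ 2)).
    apply: ler_sum => j _; rewrite -real_normK ?num_real// lerXn2r// nnegrE//.
  rewrite sumr_const card_ord -[leLHS]mulr_natr ler_wpM2r// lerXn2r ?nnegrE ?mulr_ge0//.
  by rewrite ler_peMl.
have cc : lpnorm 1 c <= lpnorm 1 c0.
  by apply: mini; rewrite lpnorm2E -(ger0_norm eta0) -sqrtr_sqr ler_sqrt ?sqr_ge0.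
have feas2 : \sum_j (sampling_matrix psi x *m c - y) j 0 ^+ 2 <= eta ^+ 2.
  by rewrite -(@ler_sqrt _ _ (eta ^+ 2)) ?sqr_ge0// sqrtr_sqr (ger0_norm eta0) -lpnorm2E.
have hE : energy (c - c0) <= 4 * (Theta%:R * t) ^+ 2.
  rewrite /energy /emp ler_pdivrMl// mulrC -mulrA -eta2.
  have : \sum_j combination psi (fun i => (c - c0) i 0) (x j) ^+ 2 <=
      \sum_j (2 * (sampling_matrix psi x *m c - y) j 0 ^+ 2 +
              2 * (sampling_matrix psi x *m c0 - y) j 0 ^+ 2).
    apply: ler_sum => j _.
    have -> : combination psi (fun i => (c - c0) i 0) (x j) =
        (sampling_matrix psi x *m c - y) j 0 - (sampling_matrix psi x *m c0 - y) j 0.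
      rewrite !mxE opprB addrA subrK -sumrB; apply: eq_bigr => i _; rewrite !mxE; ring.
    exact: sqrB_le.
  move=> /le_trans; apply; rewrite big_split/= -!mulr_sumr.
  rewrite (_ : 4 * _ = 2 * eta ^+ 2 + 2 * eta ^+ 2); last by ring.
  by apply: lerD; rewrite ler_pM2l.
have r0 : 0 < Num.sqrt s%:R :> R by rewrite sqrtr_gt0.
have rL : 4 * Num.sqrt s%:R <= 2 ^+ L :> R.
  rewrite -ler_sqr ?nnegrE ?exprn_ge0 ?mulr_ge0// ?(ltW r0)// exprMn sqr_sqrtr ?ler0n//.
  rewrite -exprM mulnC exprM -!natrX -natrM ler_nat.
  by apply: leq_trans sL; rewrite leq_mul2r orbT.
rewrite -mulrA; apply: (cone_dichotomy _ _ r0 _ rL _ hE (l1_cone s0 vs cc)).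
- exact: powR_ge0.
- exact: powR_ge0.
- exact: mulr_ge0.
- exact: lower_bound_on_cone.
Qed.

End Recovery.

(** * Choice of the number of levels *)

Section Logarithms.
Context {R : realType}.

Lemma ln2_le1 : ln 2 <= 1 :> R.
Proof.
rewrite -ler_expR lnK ?posrE//; apply: le_trans (expR_ge1Dx 1).
lra.
Qed.

(** [L] is the integer part of the base 4 logarithm of [64 * s]. The logarithmic bounds use
    [1/2 <= ln 2 <= 1] and [ln 2 <= ln s]. *)
Lemma exists_dyadic_level (s : nat) : (1 < s)%N -> exists L : nat,
  [/\ (2 <= L)%N, (16 * s <= 4 ^ L)%N, (4 ^ L <= 64 * s)%N,
      L%:R <= 7 * ln s%:R :> R & ln s%:R <= 2 * L%:R :> R].
Proof.
move=> s1; have s0 : (0 < 64 * s)%N by rewrite muln_gt0 (ltnW s1).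
set L := trunc_log 4 (64 * s); exists L.
have up : (4 ^ L <= 64 * s)%N by exact: trunc_logP.
have low : (16 * s <= 4 ^ L)%N.
  have : (64 * s < 4 ^ L.+1)%N by exact: trunc_log_ltn.
  by rewrite expnS; lia.
have sR : 0 < s%:R :> R by rewrite ltr0n ltnW.
have ln4 j : ln (4 ^+ j) = 2 * j%:R * ln 2 :> R.
  have -> : 4 = 2 ^+ 2 :> R by rewrite expr2; lra.
  by rewrite -exprM lnXn// -[LHS]mulr_natr natrM; ring.
split => //.
- by rewrite leqNgt; apply/negP; rewrite ltnS => L1; have := leq_pexp2l (isT : 0 < 4)%N L1; lia.
- have : (4 ^ L)%:R <= (2 ^ 6 * s)%:R :> R by rewrite ler_nat.
  rewrite natrM !natrX -ler_ln ?posrE ?mulr_gt0 ?exprn_gt0//.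
  rewrite lnM ?posrE ?exprn_gt0// ln4 lnXn// => h.
  have : ln 2 <= ln s%:R :> R by rewrite ler_ln ?posrE// ler_nat.
  have := @half_le_ln2 R; rewrite -[ln 2 *+ 6]mulr_natr in h.
  have := ler0n R L; nra.
- have : s%:R <= 4 ^+ L :> R by rewrite -natrX ler_nat; apply: leq_trans low; rewrite leq_pmull.
  rewrite -ler_ln ?posrE ?exprn_gt0// ln4 => h; apply: (le_trans h).
  by rewrite ler_piMr ?mulr_ge0// ln2_le1.
Qed.

End Logarithms.

(** The coefficients form an initial segment of a series with nonnegative terms; the comparison also
    covers an infinite sum. *)
Lemma lpnorm_le_Aq_norm (R : realType) (a b : R) (nu : R -> R) (N : nat) (q : R)
    (psi : 'I_N.+1 -> {poly R}) (Psi : nat -> {poly R}) (f : R -> R) (c : 'cV[R]_N.+1) :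
  0 < q -> (forall k : 'I_N.+1, Psi k = psi k) ->
  (forall k, c k 0 = dot a b nu f (horner (psi k))) ->
  (((\sum_i `|c i 0| `^ q) `^ q^-1)%:E <= Aq_norm a b nu q Psi f)%E.
Proof.
move=> q0 Psipsi cE; rewrite /Aq_norm /lqnorm_seq -poweR_EFin.
have S0 : 0 <= \sum_i `|c i 0| `^ q by apply: sumr_ge0 => i _; exact: powR_ge0.
apply: gt0_ler_poweR; first by rewrite invr_ge0 ltW.
- by rewrite in_itv/= lee_fin S0 leey.
- by rewrite in_itv/= leey andbT; apply: nneseries_ge0 => k _ _; rewrite lee_fin powR_ge0.
apply: le_trans (nneseries_lim_ge N.+1 _); last by move=> k _ _; rewrite lee_fin powR_ge0.
rewrite big_mkord sumEFin lee_fin; apply: ler_sum => i _.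
by rewrite cE Psipsi.
Qed.

(** * Assembly of the two error bounds *)

Theorem theorem4p1 (R : realType) :
  exists C C1 C2 gamma : R,
    [/\ 0 < C, 0 < C1, 0 < C2 & 0 < gamma] /\
  forall (q : R) (Theta : nat) (a b : R) (nu : R -> R) (N m s : nat) (K : R)
         (psi : 'I_N.+1 -> {poly R}),
    0 < q -> q < 1 ->
    (0 < Theta)%N ->
    a < b ->
    probability_density a b nu ->
    (0 < N)%N -> (0 < m)%N -> (0 < s)%N ->
    1 <= K ->
    C * K ^+ 2 * s%:R * ln s%:R ^+ 3 * ln N.+1%:R <= m%:R ->
    orthonormal a b nu psi ->
    (forall j k : 'I_N.+1, (j < k)%N -> (size (psi j) < size (psi k))%N) ->
    (forall k : 'I_N.+1, (size (psi k) <= N.+1)%N) ->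
    (forall k : 'I_N.+1, supnorm a b (horner (psi k)) <= K) ->
  forall (d : measure_display) (T : measurableType d) (P : probability T R)
         (X : 'I_m -> {RV P >-> R}),
    mutually_independent X ->
    (forall j, has_density a b nu (X j)) ->
  forall (f : R -> R) (p_opt : {poly R}) (c_opt : 'cV[R]_N.+1),
    {within `[a, b], continuous f} ->
    best_square_approx a b nu f N p_opt ->
    p_opt = expansion psi c_opt ->
  let T_N := fun x => f x - p_opt.[x] in
  with_probability_at_least P (1 - N.+1%:R `^ (- (gamma * ln s%:R ^+ 3)))
    [set w : T |
      let A := sampling_matrix psi (fun j => X j w) in
      let y : 'cV[R]_m := \col_j f (X j w) in
      forall c : 'cV[R]_N.+1,
        l1_minimizer A y (Theta%:R * Num.sqrt m%:R * supnorm a b T_N) c ->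
        let err := L2norm a b nu (fun x => f x - (expansion psi c).[x]) in
        err <= L2norm a b nu T_N
               + C1 * (best_sterm_error s 1 c_opt / Num.sqrt s%:R)
               + C2 * Theta%:R * supnorm a b T_N
        /\
        forall Psi : nat -> {poly R}, orthonormal_extension a b nu psi Psi ->
          (err%:E <= (L2norm a b nu T_N)%:E
                     + C1%:E * Aq_norm a b nu q Psi f
                             * (s%:R `^ (2^-1 - q^-1))%:E
                     + (C2 * Theta%:R * supnorm a b T_N)%:E)%E].
Proof.
(* The factors 64 and 343 = 7^3 come from [4^L <= 64 s] and [L <= 7 ln s]; the others
   are the constant of [uniform_lower_bound]. *)
exists (8 * 64 * 64 * 256 * 64 * 343), 1, 22, 8^-1; split.
  by split; lra.
move=> q Theta a b nu N m s K psi q0 q1 Th0 ab hnu N0 m0 s0 K1 mC orth _ psize psup.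
move=> d T P X indep dens f p_opt c_opt cf hp pE T_N.
have NR : 0 < N.+1%:R :> R by rewrite ltr0n.
(* For [s = 1] the logarithm vanishes and the required probability is [1 - (N + 1) ^ 0 = 0], so the
   empty event suffices. *)
have [s1|s1] := leqP s 1.
  have -> : s = 1%N by apply/eqP; rewrite eqn_leq s1.
  rewrite ln1 expr0n mulr0 oppr0 powRr0 subrr.
  by exists set0; split => //; rewrite measure0.
have [L [L2 sL Ls Lln lnL]] := @exists_dyadic_level R s s1.
have bf := within_continuous_bm ab cf.
have psiK i y : y \in `[a, b] -> `|(psi i).[y]| <= K.
  by move=> yI; apply: le_trans (psup i); apply: le_supnorm => //; exact: bm_horner.
have bT : bounded_measurable a b T_N by apply: bmB => //; exact: bm_horner.
have T0 : 0 <= supnorm a b T_N.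
  have aI : a \in `[a, b] by rewrite in_itv/= lexx ltW.
  exact: le_trans (le_supnorm bT aI).
have Lam0 : 0 <= ln N.+1%:R :> R by rewrite ln_ge0// ler1n.
have sig0 : 0 <= ln s%:R :> R by rewrite ln_ge0// ler1n.
have mL : 8 * 64 * 64 * 256 * K ^+ 2 * 4 ^+ L * L%:R ^+ 3 * ln N.+1%:R <= m%:R :> R.
  apply: le_trans mC; rewrite ler_wpM2r//.
  have h1 : 4 ^+ L <= 64 * s%:R :> R by rewrite -natrX -natrM ler_nat.
  have h2 : L%:R ^+ 3 <= 343 * ln s%:R ^+ 3 :> R.
    have -> : 343 * ln s%:R ^+ 3 = (7 * ln s%:R) ^+ 3 :> R by rewrite exprMn; congr (_ * _); ring.
    by rewrite lerXn2r ?nnegrE ?mulr_ge0.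
  have h3 : 4 ^+ L * L%:R ^+ 3 <= (64 * s%:R) * (343 * ln s%:R ^+ 3) :> R.
    by apply: ler_pM => //; rewrite exprn_ge0.
  have K2 : 0 <= 8 * 64 * 64 * 256 * K ^+ 2 by have := sqr_ge0 K; lra.
  by have := ler_wpM2l K2 h3; lra.
have := uniform_lower_bound hnu N0 K1 orth psiK L2 m0 indep dens mL.
apply: wp_weaken.
  (* The value [gamma = 1/8] comes from cubing [ln s <= 2 * L]. *)
  rewrite lerD2l lerN2 /powR gt_eqF// ler_expR mulNr lerN2 ler_wpM2r//.
  have : ln s%:R ^+ 3 <= (2 * L%:R) ^+ 3 :> R by rewrite lerXn2r ?nnegrE ?mulr_ge0.
  rewrite exprMn (_ : 2 ^+ 3 = 8 :> R); last by ring.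
  lra.
move=> w /= [wI lower] c cmin.
have rs0 : 0 < Num.sqrt s%:R :> R by rewrite sqrtr_gt0 ltr0n.
(* The vector [A c_opt - y] samples [- T_N], and on this event the sample points lie in [[a, b]]. *)
have noise j : `|(sampling_matrix psi (fun j => X j w) *m c_opt -
    \col_j f (X j w)) j 0| <= supnorm a b T_N.
  have -> : (sampling_matrix psi (fun j => X j w) *m c_opt - \col_j f (X j w)) j 0 =
      - T_N (X j w).
    rewrite /T_N pE horner_expansion opprB !mxE; congr (_ - _).
    by apply: eq_bigr => k _; rewrite !mxE mulrC.
  by rewrite normrN; exact: le_supnorm.
have err_sigma : lpnorm 2 (c - c_opt) <=
    best_sterm_error s 1 c_opt / Num.sqrt s%:R + 22 * Theta%:R * supnorm a b T_N.
  (* The estimate holds for every [s]-sparse [v]; the infimum is taken over a set made nonempty by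
     [v = 0]. *)
  rewrite -lerBlDr ler_pdivlMr//; apply: lb_le_inf.
    exists (lpnorm 1 (c_opt - 0)); exists 0 => //=.
    rewrite /l0norm (_ : [set i | _]%SET = finset.set0) ?cards0//.
    by apply/setP => i; rewrite !inE mxE eqxx.
  move=> _ [v vs <-]; rewrite -ler_pdivlMr// lerBlDr.
  exact: (l1_minimizer_error m0 s0 sL lower Th0 T0 noise cmin vs).
have err_le := L2norm_error_le hnu orth psize bf hp pE c.
split; first by rewrite mul1r -/T_N in err_le *; lra.
move=> Psi [_ _ Psipsi].
have coef := coefficient_best_approx hnu orth psize bf hp pE.
have Aq := lpnorm_le_Aq_norm q0 Psipsi coef.
set W := (\sum_i _) `^ _ in Aq.
have := stechkin c_opt (introT andP (conj q0 q1)) s0; rewrite -/W => st.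
have e1 : s%:R `^ (1 - q^-1) / Num.sqrt s%:R = s%:R `^ (2^-1 - q^-1) :> R.
  rewrite -powR12_sqrt ?ler0n// -powRN -powRD; first by congr (_ `^ _); lra.
  by rewrite pnatr_eq0 -lt0n s0 implybT.
apply: (@le_trans _ _ ((L2norm a b nu T_N)%:E + 1%:E * W%:E * (s%:R `^ (2^-1 - q^-1))%:E
   + (22 * Theta%:R * supnorm a b T_N)%:E)%E).
  rewrite -!EFinM -!EFinD lee_fin mul1r -e1.
  have : best_sterm_error s 1 c_opt / Num.sqrt s%:R <=
      s%:R `^ (1 - q^-1) * W / Num.sqrt s%:R by rewrite ler_pM2r ?invr_gt0.
  by rewrite mulrA [W * _]mulrC; rewrite -/T_N in err_le; lra.
apply: leeD => //; apply: leeD => //; rewrite !mul1e.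
by apply: lee_wpmul2r => //; rewrite lee_fin powR_ge0.
Qed.
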